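(* Let $(X_{n,j})_{n,j\in\mathbb{N}}$ be a family of independent random variables, each uniformly distributed on $[0,1)$. Let $\alpha>1$ and $\beta>1$ satisfy $(\zeta(\alpha)-1)(\zeta(\beta)-1)<1$, where $\zeta$ is the Riemann zeta function. Let $B=178$ and let $A_s$ ($s\in\mathbb{N}$) be the constants defined in the context. Then $$\mathbb{P}\left(D_N^{s}(\mathcal{P}_{N,s})\le \sqrt{\alpha A_s+\beta B\,\frac{\ln(\log_2 N)}{s}}\,\sqrt{\frac{s}{N}}\ \text{ for all } s\in\mathbb{N} \text{ and all } N\ge 2\right)>1-(\zeta(\alpha)-1)(\zeta(\beta)-1).$$ Moreover, $A_s\le 2548$ for all $s\in\mathbb{N}$.
   Context: For $s,N\in\mathbb{N}$, $\mathcal{P}_{N,s}$ denotes the finite sequence of $N$ points $X^{(n)}_s=(X_{n,1},\dots,X_{n,s})\in[0,1)^s$, $n=1,\dots,N$ (the upper-left $N\times s$ block of the matrix, rows read as points). For points $x_1,\dots,x_N\in[0,1)^s$, the (extreme) discrepancy is $$D_N^{s}(x_1,\dots,x_N)=\sup_{a,b\in[0,1]^s}\left|\frac1N\sum_{k=1}^N \mathbf{1}_{[a,b)}(x_k)-\lambda([a,b))\right|,$$ where $[a,b)=\{z\in[0,1)^s: a\le z<b\}$ (componentwise inequalities) and $\lambda$ is $s$-dimensional Lebesgue measure. Define $b_{-1}=b_0=3$ and $b_k=2^{-k+3}(1-2^{-k})$ for $k\ge1$. Let $C_s=\max\{1,1.1^{s-101}\}$. For $k\ge0$ set $$a_{k,s}=b_k\left(\frac{\ln\!\left(\frac{C_s^2}{\pi}\,2^{k+2}\right)}{s}+2\ln\!\left(2e(2^{k+2}+1)\right)\right),$$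 and $a_{-1,s}=a_{0,s}$. Put $A_s=2\left(\sum_{k=-1}^{\infty}\sqrt{a_{k,s}}\right)^2$. *)

(* Defs.v *)
From HB Require Import structures.
From mathcomp Require Import all_boot all_order all_algebra.
From mathcomp Require Import all_classical all_reals all_analysis.
Set Implicit Arguments. Unset Strict Implicit. Unset Printing Implicit Defensive.
Import Order.TTheory GRing.Theory Num.Theory.
Import numFieldNormedType.Exports.
Local Open Scope classical_set_scope.
Local Open Scope ring_scope.

Section Defs.
Variable R : realType.

Definition zeta (x : R) : R := limn (fun M => \sum_(1 <= n < M) (n%:R `^ (- x))).

Definition mutually_independent {d} {T : measurableType d} (P : probability T R)
  (I : eqType) (X : I -> T -> R) : Prop :=
  forall (J : seq I) (B : I -> set R), uniq J ->
    (forall i, i \in J -> measurable (B i)) ->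
    P (\bigcap_(i in [set i | i \in J]) (X i @^-1` B i)) =
    (\big[*%E/1%E]_(i <- J) P (X i @^-1` B i))%E.

Definition uniform01 {d} {T : measurableType d} (P : probability T R) (X : T -> R) : Prop :=
  forall B : set R, measurable B ->
    P (X @^-1` B) = (@lebesgue_measure R) (B `&` `[0%R, 1%R[).

(** Points: pts n j = j-th coordinate of the n-th point (0-based indices);
    the sequence P_{N,s} consists of the points n < N with coordinates j < s. *)
Definition box_count (s N : nat) (pts : nat -> nat -> R) (a b : nat -> R) : nat :=
  (\sum_(k < N) [forall j : 'I_s, (a j <= pts k j)%R && (pts k j < b j)%R])%N.

Definition box_vol (s : nat) (a b : nat -> R) : R :=
  \prod_(j < s) Num.max (b j - a j) 0.

Definition in01 (s : nat) (a : nat -> R) : Prop := forall j, (j < s)%N -> 0 <= a j <= 1.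

Definition discrepancy (s N : nat) (pts : nat -> nat -> R) : R :=
  sup [set r | exists a b : nat -> R, in01 s a /\ in01 s b /\
         r = `| (box_count s N pts a b)%:R / N%:R - box_vol s a b |].

Definition bcoef (k : nat) : R :=
  if k == 0%N then 3 else 2 ^+ 3 / 2 ^+ k * (1 - (2 ^+ k)^-1).

Definition Cconst (s : nat) : R := Num.max 1 ((11 / 10) `^ (s%:R - 101)).

Definition acoef (k s : nat) : R :=
  bcoef k * (ln (Cconst s ^+ 2 / pi * 2 ^+ (k + 2)) / s%:R
             + 2 * ln (2 * expR 1 * (2 ^+ (k + 2) + 1))).

(** A_s = 2 (sum_{k >= -1} sqrt a_{k,s})^2 with a_{-1,s} = a_{0,s} *)
Definition Aconst (s : nat) : R :=
  2 * (Num.sqrt (acoef 0 s) + limn (fun M => \sum_(0 <= k < M) Num.sqrt (acoef k s))) ^+ 2.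

Definition log2 (x : R) : R := ln x / ln 2.

Definition Bconst : R := 178.

(** The event of the theorem, for points given by Y (Y n j t = X_{n+1,j+1}(t)). *)
Definition good_event {T : Type} (Y : nat -> nat -> T -> R) (alpha beta : R) : set T :=
  [set t | forall s N : nat, (0 < s)%N -> (2 <= N)%N ->
     discrepancy s N (fun n j => Y n j t) <=
       Num.sqrt (alpha * Aconst s + beta * Bconst * ln (log2 N%:R) / s%:R)
       * Num.sqrt (s%:R / N%:R)].

End Defs.

(* Main.v *)
Require Import Defs.
From HB Require Import structures.
From mathcomp Require Import all_boot all_order all_algebra.
From mathcomp Require Import all_classical all_reals all_analysis.
From mathcomp Require Import measurable_realfun.
From mathcomp Require Import ring lra.
Set Implicit Arguments. Unset Strict Implicit. Unset Printing Implicit Defensive.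
Import Order.TTheory GRing.Theory Num.Theory.
Import numFieldNormedType.Exports.
Local Open Scope classical_set_scope.
Local Open Scope ring_scope.

(** Write [N D_N] as the supremum over boxes of the centered count [S_N] of the
    points in the box, and split [N >= 2] into dyadic blocks [2^m <= N < 2^(m+1)].
    For fixed [s] and [m], put [u = alpha A_s s + beta B ln m].  If [u >= 2^(m+1)],
    the claimed bound exceeds [1] and is trivial.  Otherwise every box is
    approximated along a chain of boxes from finite bracketing covers of precision
    [2^-(k+1)], [k = 0, ..., K]; the indicator of the difference of two consecutive
    boxes has variance at most [2^-k (1 - 2^-k)], and an exponential-moment maximal
    inequality controls its partial sums for all [N < 2^(m+1)] at once at the level
    [sqrt (a_(k,s) 2^(m+1) u / A_s)].  The levels sum up to [sqrt (u 2^m)], and the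
    union bound over the chain is at most [(s+1)^-alpha (m+1)^-beta].

    The covers are built from a geometric grid of ratio [q] with [1 - q^s] about
    the precision: a box [[0, x)] is described by the exponent vector of [x],
    truncated to a bounded sum, which leaves about [(e (1 + (k+2) 2^(k+2)))^s]
    vectors.  This is more than the optimal number, but the exponential estimates
    have room for it.

    Summing over [s >= 1] and [m >= 2] gives
    [(zeta alpha - 1) (zeta beta - 1 - 2^-beta)]; the missing term [m = 1] makes the
    inequality strict. *)

(** * Elementary inequalities *)

Section elementary_bounds.
Variable R : realType.
Implicit Types x y z c p v : R.

(** Comparing [expR x] with [1 + x + c * x ^+ 2] amounts to comparing [h c x] with [h c 0 = 1], and
    the derivative of [h c] has the sign of [z * ((2 * c - 1) - c * z)]. *)
Let h c z : R := (1 + z + c * z ^+ 2) * expR (- z).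

Let is_derive_h c x : is_derive x 1 (h c) (x * ((2 * c - 1) - c * x) * expR (- x)).
Proof.
rewrite /h; apply: is_derive_eq.
rewrite /GRing.scale /=. ring.
Qed.

Let h_MVT c x y : x <= y -> exists2 z, x <= z <= y &
  h c y - h c x = z * ((2 * c - 1) - c * z) * expR (- z) * (y - x).
Proof.
move=> xy.
have [||z zxy ->] := @MVT_segment R (h c) (fun z => z * ((2 * c - 1) - c * z) * expR (- z)) x y xy.
- by move=> z _; exact: is_derive_h.
- apply: continuous_subspaceT => z; apply: differentiable_continuous.
  by apply/derivable1_diffP; have k := is_derive_h c z; exact: ex_derive.
- by exists z => //; move: zxy; rewrite in_itv.
Qed.

Let h_ge1 c x : (1 <= h c x) = (expR x <= 1 + x + c * x ^+ 2).
Proof. by rewrite /h expRN ler_pdivlMr ?expR_gt0// mul1r. Qed.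

Let h_le1 c x : (h c x <= 1) = (1 + x + c * x ^+ 2 <= expR x).
Proof. by rewrite /h expRN ler_pdivrMr ?expR_gt0// mul1r. Qed.

Let h0 c : h c 0 = 1.
Proof. by rewrite /h oppr0 expR0 expr0n/= mulr0 !addr0 mulr1. Qed.

Lemma expR_ge_quad x : 0 <= x -> 1 + x + 2^-1 * x ^+ 2 <= expR x.
Proof.
move=> x0; rewrite -h_le1 -subr_le0.
have [z /andP[z0 zx]] := h_MVT 2^-1 x0; rewrite h0 => ->.
rewrite subr0 mulr_le0_ge0// mulr_le0_ge0 ?expR_ge0//.
by rewrite mulr_ge0_le0//; lra.
Qed.

Lemma expR1_le : expR 1 <= 11 / 4 :> R.
Proof.
(* For [c = 4 / 9] the second zero of the derivative is [- 4^-1], so [h] increases on [[- 4^-1, 0]];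
   at the left end the quadratic equals [7 / 9], and [(9 / 7) ^+ 4 < 11 / 4]. *)
have e4 : expR 4^-1 <= 9 / 7 :> R.
  have : h (4 / 9) (- 4^-1) <= 1.
    rewrite -subr_ge0; have : - 4^-1 <= 0 :> R by lra.
    move=> /(h_MVT (4 / 9))[z /andP[z0 z1]]; rewrite h0 => ->.
    rewrite mulr_ge0 ?subr_ge0 ?oppr_le0//.
    rewrite mulr_ge0 ?expR_ge0// mulr_le0//. lra.
  rewrite /h opprK; have := expR_gt0 (4^-1 : R); set e := expR _; nra.
have -> : 1 = 4%:R * 4^-1 :> R by rewrite mulfV.
rewrite expRM_natl; apply: (le_trans (lerXn2r 4 _ _ e4)); rewrite ?nnegrE ?expR_ge0//; lra.
Qed.

(** For [c = 3 / 4] the function [h] decreases on [[-1, 0]], increases up to [2 / 3] and decreases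
    afterwards, so only its values at [0] and [1] matter; at [1] the claim is [expR 1 <= 11 / 4]. *)
Lemma expR_le_quad x : -1 <= x <= 1 -> expR x <= 1 + x + 3 / 4 * x ^+ 2.
Proof.
move=> /andP[xge xle]; rewrite -h_ge1 -subr_ge0.
have [x0|x0] := leP x 0.
  rewrite -opprB oppr_ge0.
  have [z /andP[zx z0]] := h_MVT (3 / 4) x0; rewrite h0 => ->.
  rewrite mulr_le0_ge0 ?subr_ge0// mulr_le0_ge0 ?expR_ge0//.
  by rewrite mulr_le0_ge0//; lra.
have [x23|x23] := leP x (2 / 3).
  have [z /andP[z0 zx]] := h_MVT (3 / 4) (ltW x0); rewrite h0 => ->.
  rewrite mulr_ge0 ?subr_ge0// ?(ltW x0)// mulr_ge0 ?expR_ge0//.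
  by rewrite mulr_ge0//; lra.
rewrite subr_ge0 (@le_trans _ _ (h (3 / 4) 1))//.
  by rewrite h_ge1; have := expR1_le; lra.
rewrite -subr_le0.
have [z /andP[z0 zx] ->] := h_MVT (3 / 4) xle.
rewrite mulr_le0_ge0 ?subr_ge0// mulr_le0_ge0 ?expR_ge0//.
by rewrite mulr_ge0_le0//; lra.
Qed.

Lemma ln2_le : ln 2 <= 7 / 10 :> R.
Proof.
rewrite -[leRHS]expRK ler_ln ?posrE ?expR_gt0//.
have -> : 7 / 10 = 4%:R * (7 / 40) :> R by lra.
rewrite expRM_natl.
have e : 119 / 100 <= expR (7 / 40) :> R by apply: le_trans (expR_ge_quad _); lra.
by apply: le_trans (lerXn2r 4 _ _ e); rewrite ?nnegrE ?expR_ge0//; lra.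
Qed.

Lemma ln2_ge : 2 / 3 <= ln 2 :> R.
Proof.
rewrite -[leLHS]expRK ler_ln ?posrE ?expR_gt0//.
rewrite -(@ler_pXn2r _ 3) ?nnegrE ?expR_ge0// -expRM_natl.
have -> : 3%:R * (2 / 3) = 2%:R * 1 :> R by lra.
rewrite expRM_natl.
have := expR1_le; have := expR_ge0 (1 : R); set e := expR 1; nra.
Qed.

(** The quadratic bound applies to both exponentials; the linear terms cancel and the quadratic ones
    add up to the exponent on the right. *)
Lemma centered_bernoulli_mgf p v : 0 <= p <= 1 -> -1 <= v <= 1 ->
  p * expR (v * (1 - p)) + (1 - p) * expR (v * - p) <=
  expR (3 / 4 * v ^+ 2 * (p * (1 - p))).
Proof.
move=> /andP[p0 p1] /andP[v0 v1].
apply: le_trans (expR_ge1Dx _).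
have h1 : expR (v * (1 - p)) <= 1 + v * (1 - p) + 3 / 4 * (v * (1 - p)) ^+ 2.
  by apply: expR_le_quad; apply/andP; split; nra.
have h2 : expR (v * - p) <= 1 + v * - p + 3 / 4 * (v * - p) ^+ 2.
  by apply: expR_le_quad; apply/andP; split; nra.
have := ler_wpM2l p0 h1; have q0 : 0 <= 1 - p by lra.
have := ler_wpM2l q0 h2; nra.
Qed.

End elementary_bounds.

(** * Real-valued probabilities and independence of differences *)

Section real_valued_probability.
Context {d : measure_display} {T : measurableType d} {R : realType}.
Variable P : probability T R.
Implicit Types A B U V : set T.

Definition pr A : R := fine (P A).

Lemma pr_fineK A : measurable A -> (pr A)%:E = P A.
Proof. by move=> mA; rewrite /pr fineK// fin_num_measure. Qed.

Lemma pr_ge0 A : 0 <= pr A.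
Proof. by rewrite /pr fine_ge0. Qed.

Lemma prT : pr setT = 1.
Proof. by rewrite /pr probability_setT. Qed.

Lemma pr0 : pr set0 = 0.
Proof. by rewrite /pr measure0. Qed.

Lemma le_pr A B : measurable A -> measurable B -> A `<=` B -> pr A <= pr B.
Proof.
by move=> mA mB AB; rewrite -lee_fin !pr_fineK// le_measure// inE.
Qed.

Lemma prD U V : measurable U -> measurable V -> V `<=` U ->
  pr (U `\` V) = pr U - pr V.
Proof.
move=> mU mV VU; apply: EFin_inj; rewrite EFinB !pr_fineK//; last exact: measurableD.
rewrite measureD//; last by rewrite ltey_eq fin_num_measure.
by rewrite setIidr.
Qed.

Lemma prC U : measurable U -> pr (~` U) = 1 - pr U.
Proof. by move=> mU; rewrite -setTD prD// prT. Qed.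

Lemma pr_le1 A : measurable A -> pr A <= 1.
Proof. by move=> mA; rewrite -prT le_pr. Qed.

Lemma pr_U_le A B : measurable A -> measurable B -> pr (A `|` B) <= pr A + pr B.
Proof.
move=> mA mB; rewrite -lee_fin EFinD !pr_fineK//; last exact: measurableU.
by rewrite measureU2.
Qed.

Lemma pr_bigcup_fin_le (I : finType) (F : I -> set T) :
  (forall i, measurable (F i)) ->
  measurable [set t | exists i, F i t] /\
  pr [set t | exists i, F i t] <= \sum_i pr (F i).
Proof.
move=> mF.
have -> : [set t | exists i, F i t] = \big[setU/set0]_i F i.
  rewrite -bigcup_seq; apply/seteqP; split=> [t [i Fi]|t [i _ Fi]]; exists i => //=.
  exact: mem_index_enum.
elim/big_rec2 : _ => [|i x A _ [mA IH]]; first by rewrite pr0.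
split; first exact: measurableU.
by apply: (le_trans (pr_U_le _ _)) => //; rewrite lerD2l.
Qed.

End real_valued_probability.

Section difference_independence.
Context {d : measure_display} {T : measurableType d} {R : realType}.
Variables (P : probability T R) (C : nat -> set (set T)).
Hypothesis mC : forall n A, C n A -> measurable A.
Hypothesis CT : forall n, C n setT.
Hypothesis indepC : forall N (A : nat -> set T), (forall n, C n (A n)) ->
  pr P (\big[setI/setT]_(i < N) A i) = \prod_(i < N) pr P (A i).

Definition difference_event n (A : set T) := exists U V,
  [/\ C n U, C n V, V `<=` U & A = U `\` V \/ A = ~` (U `\` V)].

Lemma measurable_difference_event n A : difference_event n A -> measurable A.
Proof.
move=> [U [V [/mC mU /mC mV _ []->]]]; first exact: measurableD.
by apply: measurableC; exact: measurableD.
Qed.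

(** The events are replaced one at a time. The product formula is additive under proper differences,
    so it passes from [U] and [V] to their difference, and with [setT] to the complement. *)
Lemma indep_difference_event N (A : nat -> set T) :
  (forall n, difference_event n (A n)) ->
  pr P (\big[setI/setT]_(i < N) A i) = \prod_(i < N) pr P (A i).
Proof.
move=> DA.
have main k : forall B : nat -> set T, (forall n, (n < k)%N -> difference_event n (B n)) ->
    (forall n, (k <= n)%N -> C n (B n)) ->
    pr P (\big[setI/setT]_(i < N) B i) = \prod_(i < N) pr P (B i).
  elim: k => [|k IH] B DB CB; first by apply: indepC => n; exact: CB.
  have [kN|Nk] := ltnP k N; last first.
    (* Only the first [N] events count; padding with [setT], which is both in [C n] and a difference
       event, lets the hypothesis for [k] apply. *)
    pose B' n := if (n < N)%N then B n else setT.
    have /IH : forall n, (n < k)%N -> difference_event n (B' n).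
      move=> n nk; rewrite /B'; case: ifPn => _; first by apply: DB; rewrite ltnS ltnW.
      by exists setT, setT; split => //; right; rewrite setDv setC0.
    move=> /(_ _)/=; have CB' : forall n, (k <= n)%N -> C n (B' n).
      by move=> n kn; rewrite /B' ltnNge (leq_trans Nk kn) /=.
    move=> /(_ CB') h.
    transitivity (pr P (\big[setI/setT]_(i < N) B' i)).
      by congr (pr P _); apply: eq_bigr => i _; rewrite /B' ltn_ord.
    by rewrite h; apply: eq_bigr => i _; rewrite /B' ltn_ord.
  pose o := Ordinal kN.
  pose rest := \big[setI/setT]_(i < N | i != o) B i.
  pose rho := \prod_(i < N | i != o) pr P (B i).
  have mB n : measurable (B n).
    have [nk|kn] := ltnP n k.+1; first exact: measurable_difference_event (DB n nk).
    exact: mC (CB _ kn).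
  have mrest : measurable rest by apply: bigsetI_measurable.
  (* With a member of [C k] in position [k] only the first [k] events are differences, so the
     induction hypothesis splits it off. *)
  have G Y : C k Y -> pr P (Y `&` rest) = pr P Y * rho.
    move=> CY; pose B' n := if n == k then Y else B n.
    have : pr P (\big[setI/setT]_(i < N) B' i) = \prod_(i < N) pr P (B' i).
      apply: IH => n nk; rewrite /B'.
        by rewrite ltn_eqF//; apply: DB; rewrite ltnS ltnW.
      by case: eqVneq => [->//|nek]; apply: CB; rewrite ltn_neqAle eq_sym nek.
    rewrite (bigD1 o)//= [in RHS](bigD1 o)//=.
    have -> : B' k = Y by rewrite /B' eqxx.
    have -> : \big[setI/setT]_(i < N | i != o) B' i = rest.
      by apply: eq_bigr => i io; rewrite /B' -[_ == k]/(i == o) (negbTE io).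
    have -> // : \prod_(i < N | i != o) pr P (B' i) = rho.
      by apply: eq_bigr => i io; rewrite /B' -[_ == k]/(i == o) (negbTE io).
  rewrite (bigD1 o)//= [in RHS](bigD1 o)//= -/rest -/rho.
  have [U [V [CU CV VU]]] := DB k (ltnSn k).
  have mU := mC CU; have mV := mC CV.
  have GD : pr P ((U `\` V) `&` rest) = pr P (U `\` V) * rho.
    have -> : (U `\` V) `&` rest = (U `&` rest) `\` (V `&` rest).
      by apply/seteqP; split=> t /=; tauto.
    rewrite prD//; [|exact: measurableI|exact: measurableI|exact: setSI].
    by rewrite !G// prD// mulrBl.
  case=> ->//.
  have mD : measurable (U `\` V) by exact: measurableD.
  have -> : ~` (U `\` V) `&` rest = rest `\` ((U `\` V) `&` rest).
    by apply/seteqP; split=> t /=; tauto.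
  rewrite prD//; [|exact: measurableI].
  have := G setT (CT k); rewrite setTI prT mul1r => ->.
  by rewrite GD prC// mulrBl mul1r.
pose A' n := if (n < N)%N then A n else setT.
have /main : forall n, (n < N)%N -> difference_event n (A' n) by move=> n nN; rewrite /A' nN.
have CA' n : (N <= n)%N -> C n (A' n) by rewrite /A' leqNgt => /negbTE->.
move=> /(_ CA') e; have eA (i : 'I_N) : A' i = A i by rewrite /A' ltn_ord.
transitivity (pr P (\big[setI/setT]_(i < N) A' i)).
  by congr (pr P _); apply: eq_bigr => i _; rewrite eA.
by rewrite e; apply: eq_bigr => i _; rewrite eA.
Qed.
End difference_independence.

(** * A maximal Bernstein inequality *)

Section maximal_inequality.
Context {d : measure_display} {T : measurableType d} {R : realType}.
Variables (P : probability T R) (E : nat -> set T) (p : R).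
Hypothesis mE : forall n, measurable (E n).
Hypothesis p01 : 0 <= p <= 1.

Definition cylinder n (w : nat -> bool) : set T :=
  \big[setI/setT]_(i < n) (if w i then E i else ~` E i).

Hypothesis pr_cylinder : forall n w,
  pr P (cylinder n w) = \prod_(i < n) (if w i then p else 1 - p).

Definition centered_count n t : R := \sum_(i < n) (\1_(E i) t - p).

Lemma measurable_centered_count n : measurable_fun setT (centered_count n).
Proof.
apply: measurable_sum => i; exact: measurable_funB.
Qed.

(** The crossing of [r] is counted from time [n] on, so that an induction on the remaining time [k]
    can move the start. *)
Let hit v r n k := [set t | exists2 m, (m <= k)%N & r <= v * centered_count (n + m) t].

Let measurable_hit v r n k : measurable (hit v r n k).
Proof.
have -> : hit v r n k = \bigcup_(m in [set m | (m <= k)%N])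
    ((fun t => v * centered_count (n + m) t) @^-1` `[r, +oo[).
  apply/seteqP; split=> t.
    by move=> [m mk h]; exists m => //=; rewrite in_itv/= andbT.
  by move=> [m mk]; rewrite /= in_itv/= andbT => h; exists m.
apply: bigcup_measurable => m _; rewrite -[X in measurable X]setTI.
apply: measurable_funM => //; exact: measurable_centered_count.
Qed.

Let measurable_cylinder n w : measurable (cylinder n w).
Proof. by apply: bigsetI_measurable => i _; case: ifP => _ //; exact: measurableC. Qed.

Let sumw n (w : nat -> bool) : R := \sum_(i < n) ((w i)%:R - p).

Let centered_count_cylinder n w t : cylinder n w t -> centered_count n t = sumw n w.
Proof.
elim: n => [|n IH]; first by rewrite /centered_count /sumw !big_ord0.
rewrite /cylinder big_ord_recr/= => -[/IH{}IH].
rewrite /centered_count /sumw !big_ord_recr/= -/(centered_count n t) -/(sumw n w) IH.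
rewrite indicE; case: (w n) => En; first by rewrite mem_set.
by rewrite memNset.
Qed.

Let upd n b (w : nat -> bool) i := if i == n then b else w i.

Let cylinderS n w b : cylinder n.+1 (upd n b w) = cylinder n w `&` (if b then E n else ~` E n).
Proof.
rewrite /cylinder big_ord_recr/= /upd eqxx; congr (_ `&` _).
by apply: eq_bigr => i _; rewrite ltn_eqF.
Qed.

Let pr_cylinderS n w b :
  pr P (cylinder n.+1 (upd n b w)) = pr P (cylinder n w) * (if b then p else 1 - p).
Proof.
rewrite !pr_cylinder big_ord_recr/= /upd eqxx; congr (_ * _).
by apply: eq_bigr => i _; rewrite ltn_eqF.
Qed.

Let sumwS n w b : sumw n.+1 (upd n b w) = sumw n w + (b%:R - p).
Proof.
rewrite /sumw big_ord_recr/= /upd eqxx; congr (_ + _).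
by apply: eq_bigr => i _; rewrite ltn_eqF.
Qed.

Let mgf v : R := p * expR (v * (1 - p)) + (1 - p) * expR (v * - p).

Let mgf_ge1 v : 1 <= mgf v.
Proof.
have /andP[p0 p1] := p01; have q0 : 0 <= 1 - p by lra.
have := ler_wpM2l p0 (expR_ge1Dx (v * (1 - p))).
have := ler_wpM2l q0 (expR_ge1Dx (v * - p)).
rewrite /mgf; set e1 := expR _; set e2 := expR _; nra.
Qed.

(* Doob's inequality for [exp (v S_n)], as an induction on the remaining time. *)
Let pr_hit_cylinder v r k : forall n w,
  pr P (cylinder n w `&` hit v r n k) <=
  pr P (cylinder n w) * (expR (v * sumw n w - r) * mgf v ^+ k).
Proof.
(* Once the level is reached at time [n], both factors are at least [1] and the bound exceeds the
   probability of the cylinder. *)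
have crossed n w k' : r <= v * sumw n w -> pr P (cylinder n w `&` hit v r n k') <=
    pr P (cylinder n w) * (expR (v * sumw n w - r) * mgf v ^+ k').
  move=> h; apply: (@le_trans _ _ (pr P (cylinder n w))).
    by apply: le_pr => //; exact: measurableI.
  rewrite ler_peMr ?pr_ge0// -[1]mulr1 ler_pM// ?exprn_ege1//.
  by rewrite -expR0 ler_expR subr_ge0.
elim: k => [|k IH] n w; have [|h] := leP r (v * sumw n w); try exact: crossed.
  have -> : cylinder n w `&` hit v r n 0 = set0.
    apply/seteqP; split=> // t [cw [m]]; rewrite leqn0 => /eqP->; rewrite addn0.
    by rewrite (centered_count_cylinder cw) leNgt h.
  have m0 : 0 <= mgf v by exact: le_trans ler01 (mgf_ge1 v).
  by rewrite pr0 !mulr_ge0 ?pr_ge0 ?expR_ge0 ?exprn_ge0.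
pose A b := cylinder n.+1 (upd n b w) `&` hit v r n.+1 k.
have mA b : measurable (A b) by exact: measurableI.
(* If the level is not reached at time [n], the crossing comes later; split by whether [E n]
   occurs. *)
have sub : cylinder n w `&` hit v r n k.+1 `<=` A true `|` A false.
  move=> t [cw [[|m] mk rm]].
    by move: rm; rewrite addn0 (centered_count_cylinder cw) leNgt h.
  have ht : hit v r n.+1 k t by exists m => //; rewrite addSnnS.
  have [En|En] := pselect (E n t); [left|right]; split => //; rewrite cylinderS; split => //.
apply: (le_trans (le_pr P _ _ sub)); [exact: measurableI|exact: measurableU|].
apply: (le_trans (pr_U_le P _ _)) => //.
apply: (le_trans (lerD (IH _ _) (IH _ _))).
rewrite !pr_cylinderS !sumwS /= le_eqVlt; apply/orP; left; apply/eqP.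
rewrite add0r (_ : v * _ - r = (v * sumw n w - r) + v * (1 - p)); last by ring.
rewrite (_ : v * (sumw n w - p) - r = (v * sumw n w - r) + v * - p); last by ring.
rewrite !expRD exprS {3}/mgf; ring.
Qed.

Lemma maximal_ineq v V r k : -1 <= v <= 1 -> p * (1 - p) <= V ->
  pr P [set t | exists2 m, (m <= k)%N & r <= v * centered_count m t] <=
  expR (3 / 4 * v ^+ 2 * (k%:R * V) - r).
Proof.
move=> v1 pV; have := pr_hit_cylinder v r k 0 (fun=> false).
have c0 : cylinder 0 (fun=> false) = setT by rewrite /cylinder big_ord0.
rewrite c0 setTI prT mul1r /sumw big_ord0 mulr0 sub0r /hit /=.
move=> /le_trans; apply; rewrite addrC expRD ler_wpM2l ?expR_ge0//.
have -> : 3 / 4 * v ^+ 2 * (k%:R * V) = k%:R * (3 / 4 * v ^+ 2 * V) by ring.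
rewrite expRM_natl lerXn2r ?nnegrE ?expR_ge0//; first exact: le_trans ler01 (mgf_ge1 v).
apply: (le_trans (centered_bernoulli_mgf p01 v1)).
by rewrite ler_expR ler_wpM2l// mulr_ge0// sqr_ge0.
Qed.

Lemma maximal_ineq_abs l V r k : 0 <= l <= 1 -> p * (1 - p) <= V ->
  measurable [set t | exists2 m, (m <= k)%N & r < `|centered_count m t|] /\
  pr P [set t | exists2 m, (m <= k)%N & r < `|centered_count m t|] <=
  2 * expR (3 / 4 * l ^+ 2 * (k%:R * V) - l * r).
Proof.
move=> /andP[l0 l1] pV.
have mA : measurable [set t | exists2 m, (m <= k)%N & r < `|centered_count m t|].
  have -> : [set t | exists2 m, (m <= k)%N & r < `|centered_count m t|] =
      \bigcup_(m in [set m | (m <= k)%N]) ((fun t => `|centered_count m t|) @^-1` `]r, +oo[).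
    apply/seteqP; split=> t.
      by move=> [m mk h]; exists m => //=; rewrite in_itv/= andbT.
    by move=> [m mk]; rewrite /= in_itv/= andbT => h; exists m.
  apply: bigcup_measurable => m _; rewrite -[X in measurable X]setTI.
  apply: (measurableT_comp (@normr_measurable _ _)) => //; exact: measurable_centered_count.
split=> //; have max_measurable v : measurable
    [set t | exists2 m, (m <= k)%N & l * r <= v * centered_count m t].
  exact: measurable_hit v (l * r) 0 k.
have sub : [set t | exists2 m, (m <= k)%N & r < `|centered_count m t|] `<=`
    [set t | exists2 m, (m <= k)%N & l * r <= l * centered_count m t] `|`
    [set t | exists2 m, (m <= k)%N & l * r <= - l * centered_count m t].
  move=> t [m mk rm]; have [c0|c0] := leP 0 (centered_count m t); [left|right];
    exists m => //.
    by rewrite ler_wpM2l// -(ger0_norm c0) ltW.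
  by rewrite mulNr -mulrN ler_wpM2l// -(ltr0_norm c0) ltW.
apply: (le_trans (le_pr P _ _ sub)) => //; first exact: measurableU.
apply: (le_trans (pr_U_le P _ _)) => //.
rewrite mulrDl mul1r lerD// (le_trans (maximal_ineq _ _ _ pV))//; last by rewrite sqrrN.
  by rewrite l1 andbT (le_trans _ l0)// lerN10.
by rewrite lerN2 l1 (le_trans _ ler01)// oppr_le0.
Qed.

(* The choice of [l] is [2 x / 3] for [x <= 3 / 2] and [1] otherwise, where [x = r / (k V)]. *)
Lemma maximal_bernstein V r k : 0 < V -> (0 < k)%N -> p * (1 - p) <= V ->
  0 <= r <= 8 / 3 * (k%:R * V) ->
  measurable [set t | exists2 m, (m <= k)%N & r < `|centered_count m t|] /\
  pr P [set t | exists2 m, (m <= k)%N & r < `|centered_count m t|] <=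
  2 * expR (- (43 / 160 * (r ^+ 2 / (k%:R * V)))).
Proof.
move=> V0 k0 pV /andP[r0 r8].
have W0 : 0 < k%:R * V by rewrite mulr_gt0// ltr0n.
move: r8; set W := k%:R * V in W0 * => r8.
pose x := r / W; have rE : r = x * W by rewrite /x divfK// gt_eqF.
have x0 : 0 <= x by rewrite divr_ge0// ltW.
have x8 : x <= 8 / 3 by rewrite ler_pdivrMr.
have -> : r ^+ 2 / W = x ^+ 2 * W by rewrite rE; field; rewrite gt_eqF.
(* The constant [43 / 160] is fixed by the endpoint [x = 8 / 3], where [l = 1] gives [23 / 12],
   slightly above [43 / 160 * x ^+ 2]; the choice [2 x / 3] gives [x ^+ 2 / 3]. *)
suff [l l01 hl] : exists2 l, 0 <= l <= 1 &
    43 / 160 * x ^+ 2 <= l * x - 3 / 4 * l ^+ 2.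
  have [m le] := maximal_ineq_abs (V := V) r k l01 pV.
  split=> //; apply: (le_trans le); rewrite ler_wpM2l// ler_expR rE -/W.
  have := ler_wpM2r (ltW W0) hl; lra.
have [x32|x32] := leP x (3 / 2).
  exists (2 / 3 * x); first by apply/andP; split; lra.
  nra.
by exists 1; [rewrite ler01 lexx|nra].
Qed.

End maximal_inequality.

(** * Increments between nested boxes *)

Definition le_on {R : realType} (s : nat) (x y : nat -> R) := forall j, (j < s)%N -> x j <= y j.

Definition box_dev {R : realType} s N (pts : nat -> nat -> R) a b : R :=
  (box_count s N pts a b)%:R - N%:R * box_vol s a b.

Section box_increments.
Context {R : realType} {d : measure_display} {T : measurableType d}.
Variables (P : probability T R) (X : nat -> nat -> {RV P >-> R}) (s : nat).
Hypothesis unifX : forall n j, uniform01 P (X n j).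
Hypothesis indepX : mutually_independent P (fun ij : nat * nat => (X ij.1 ij.2 : T -> R)).

Let measurable_preim n j (B : set R) : measurable B -> measurable (X n j @^-1` B).
Proof. by move=> mB; rewrite -[X in measurable X]setTI; exact: measurable_funPT. Qed.

Let indep_pr (J : seq (nat * nat)) (B : nat * nat -> set R) : uniq J ->
  (forall i, measurable (B i)) ->
  pr P (\big[setI/setT]_(i <- J) (X i.1 i.2 @^-1` B i)) =
  \prod_(i <- J) pr P (X i.1 i.2 @^-1` B i).
Proof.
move=> uJ mB; have := indepX uJ (fun i _ => mB i).
rewrite bigcap_seq /= {1}/pr => ->.
have e i : P (X i.1 i.2 @^-1` B i) = (pr P (X i.1 i.2 @^-1` B i))%:E.
  by rewrite pr_fineK//; exact: measurable_preim.
by under eq_bigr do rewrite e; rewrite prodEFin.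
Qed.

Definition point_event n (B : nat -> set R) : set T :=
  \big[setI/setT]_(j < s) (X n j @^-1` B j).

Let point_class n : set (set T) :=
  [set A | exists2 B : nat -> set R, (forall j, measurable (B j)) & A = point_event n B].

Definition box_event n (a b : nat -> R) : set T :=
  [set t | [forall j : 'I_s, (a j <= X n j t) && (X n j t < b j)]].

Lemma box_eventE n a b : box_event n a b = point_event n (fun j => `[a j, b j[%classic).
Proof.
rewrite /point_event -bigcap_seq; apply/seteqP; split=> t.
  by move=> /forallP h j _ /=; rewrite in_itv/=.
move=> h; apply/forallP => j; have := h j; rewrite /= in_itv/=; apply.
exact: mem_index_enum.
Qed.

Let iotaE n : iota 0 n = index_iota 0 n.
Proof. by rewrite /index_iota subn0. Qed.

Let point_event_pr n B : (forall j, measurable (B j)) ->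
  pr P (point_event n B) = \prod_(j < s) pr P (X n j @^-1` B j).
Proof.
move=> mB.
have := @indep_pr [seq (n, j) | j <- iota 0 s] (fun ij => B ij.2).
rewrite !big_map /= iotaE !big_mkord; apply => //.
by rewrite map_inj_uniq ?iota_uniq// => i j [].
Qed.

Let measurable_point_event n B : (forall j, measurable (B j)) ->
  measurable (point_event n B).
Proof. by move=> mB; apply: bigsetI_measurable => j _; exact: measurable_preim. Qed.

(** Flattening the pairs of point and coordinate into one list reduces independence of the points to
    that of all coordinates. *)
Let indep_point_class N (A : nat -> set T) : (forall n, point_class n (A n)) ->
  pr P (\big[setI/setT]_(i < N) A i) = \prod_(i < N) pr P (A i).
Proof.
move=> CA; have /choice[B BE] : forall n, exists B : nat -> set R,
    (forall j, measurable (B j)) /\ A n = point_event n B.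
  by move=> n; have [B mB AE] := CA n; exists B.
have := @indep_pr [seq (i, j) | i <- iota 0 N, j <- iota 0 s] (fun ij => B ij.1 ij.2).
rewrite !big_allpairs_dep /= => h.
transitivity (pr P (\big[setI/setT]_(i <- iota 0 N)
    \big[setI/setT]_(j <- iota 0 s) (X i j @^-1` B i j))).
  congr (pr P _); rewrite iotaE big_mkord.
  apply: eq_bigr => i _; rewrite (BE i).2 /point_event.
  by rewrite iotaE big_mkord.
rewrite h; last 2 first.
- by apply: allpairs_uniq; rewrite ?iota_uniq// => -[? ?] [? ?] _ _ [-> ->].
- by move=> ij; exact: (BE _).1.
rewrite iotaE big_mkord; apply: eq_bigr => i _.
rewrite (BE i).2 point_event_pr; last exact: (BE _).1.
by rewrite iotaE big_mkord.
Qed.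

Lemma measurable_box_event n a b : measurable (box_event n a b).
Proof. by rewrite box_eventE; exact: measurable_point_event. Qed.

Lemma pr_box_event n a b : in01 s a -> in01 s b -> pr P (box_event n a b) = box_vol s a b.
Proof.
move=> a01 b01; rewrite box_eventE point_event_pr//; apply: eq_bigr => j _.
have /andP[a0 a1] := a01 _ (ltn_ord j); have /andP[b0 b1] := b01 _ (ltn_ord j).
rewrite /pr unifX// setIidl; last first.
  move=> x /=; rewrite !in_itv/= => /andP[ax xb].
  by rewrite (le_trans a0 ax) (lt_le_trans xb b1).
rewrite lebesgue_measure_itv/= lte_fin; case: ltP => ab /=.
  by rewrite max_l// subr_ge0 ltW.
by rewrite max_r// subr_le0.
Qed.

Lemma box_devE N t a b :
  box_dev s N (fun n j => X n j t) a b = \sum_(n < N) (\1_(box_event n a b) t - box_vol s a b).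
Proof.
rewrite /box_dev sumrB sumr_const card_ord mulr_natl; congr (_ - _).
rewrite /box_count natr_sum; apply: eq_bigr => n _; congr (_%:R).
case: (boolP [forall j, _]) => h.
  by rewrite mem_set.
by rewrite memNset//; exact/negP.
Qed.

Lemma box_event_sub n a b a' b' : le_on s a a' -> le_on s b' b ->
  box_event n a' b' `<=` box_event n a b.
Proof.
move=> aa bb t /forallP h; apply/forallP => j; have /andP[h1 h2] := h j.
by rewrite (le_trans (aa _ _) h1)//= (lt_le_trans h2)// bb.
Qed.

(** A point falls in the outer but not in the inner box with probability [p]; independence of these
    differences makes the increment a centered count, to which the maximal inequality applies. *)
Lemma box_increment_bernstein a b a' b' V r k :
  in01 s a -> in01 s b -> in01 s a' -> in01 s b' -> le_on s a a' -> le_on s b' b ->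
  let p := box_vol s a b - box_vol s a' b' in
  p * (1 - p) <= V -> 0 < V -> (0 < k)%N -> 0 <= r <= 8 / 3 * (k%:R * V) ->
  let F := [set t | exists2 m, (m <= k)%N &
    r < `|box_dev s m (fun n j => X n j t) a b - box_dev s m (fun n j => X n j t) a' b'|] in
  measurable F /\ pr P F <= 2 * expR (- (43 / 160 * (r ^+ 2 / (k%:R * V)))).
Proof.
move=> a01 b01 a01' b01' aa bb p pV V0 k0 rV F.
pose E n := box_event n a b `\` box_event n a' b'.
have mE n : measurable (E n) by apply: measurableD; exact: measurable_box_event.
have sub n : box_event n a' b' `<=` box_event n a b by exact: box_event_sub.
have prE n : pr P (E n) = p.
  by rewrite prD//; [rewrite !pr_box_event|exact: measurable_box_event..].
have p01 : 0 <= p <= 1 by rewrite -(prE 0%N) pr_ge0 pr_le1.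
have cyl n w : pr P (cylinder E n w) = \prod_(i < n) (if w i then p else 1 - p).
  have mC m A : point_class m A -> measurable A.
    by move=> [B mB ->]; exact: measurable_point_event.
  have CT m : point_class m setT.
    by exists (fun=> setT) => //; rewrite /point_event big1.
  have DE m : difference_event point_class m (if w m then E m else ~` E m).
    exists (box_event m a b), (box_event m a' b'); split.
    + by exists (fun j => `[a j, b j[%classic) => //; exact: box_eventE.
    + by exists (fun j => `[a' j, b' j[%classic) => //; exact: box_eventE.
    + exact: sub.
    + by case: (w m); [left|right].
  rewrite /cylinder (indep_difference_event mC CT indep_point_class n DE).
  by apply: eq_bigr => i _; case: (w i); rewrite ?prC// prE.
have FE : F = [set t | exists2 m, (m <= k)%N & r < `|centered_count E p m t|].
  suff e m t : box_dev s m (fun n j => X n j t) a b - box_dev s m (fun n j => X n j t) a' b'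
      = centered_count E p m t.
    by apply/seteqP; split=> t [m mk h]; exists m => //; move: h; rewrite e.
  rewrite !box_devE /centered_count -sumrB; apply: eq_bigr => n _.
  have -> : \1_(E n) t = \1_(box_event n a b) t - \1_(box_event n a' b') t :> R.
    rewrite !indicE /E in_setD; case: (boolP (t \in box_event n a' b')) => /= h.
      by rewrite mem_set ?subrr//; apply: sub; exact: set_mem.
    by rewrite andbT subr0.
  by rewrite /p; ring.
by rewrite FE; exact: maximal_bernstein.
Qed.

End box_increments.

(** * Bracketing covers *)

(** Raising one coordinate at a time reaches the sum [L]. This serves to cut an exponent vector down
    to the sum [cover_len]. *)
Lemma exists_subvector_sum (I : finType) (c : I -> nat) (L : nat) :
  (L <= \sum_i c i)%N -> exists2 i : I -> nat, (forall j, i j <= c j)%N & (\sum_j i j = L)%N.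
Proof.
elim: L => [|L IH] Lc; first by exists (fun=> 0%N) => //; rewrite big1.
have [i ic iL] := IH (ltnW Lc).
have [/existsP[j ij]|/existsPn h] := boolP [exists j, i j < c j]%N; last first.
  suff : (\sum_j c j <= \sum_j i j)%N by rewrite iL leqNgt Lc.
  by apply: leq_sum => j _; rewrite leqNgt h.
exists (fun j' => (j' == j) + i j')%N => [j'|].
  by case: eqVneq => [->|_]; [exact: ij|exact: ic].
rewrite big_split/= iL (bigD1 j)//= eqxx big1 ?addn0 ?add1n// => j' /negbTE -> //.
Qed.

Lemma one_minus_exprn_le (R : realType) (q : R) n : 0 <= q <= 1 ->
  1 - q ^+ n <= n%:R * (1 - q).
Proof.
move=> /andP[q0 q1]; elim: n => [|n IH]; first by rewrite expr0 subrr mul0r.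
rewrite exprS -natr1 mulrDl mul1r.
have z1 : q ^+ n <= 1 by exact: exprn_ile1.
move: IH z1; set z := q ^+ n; set w := n%:R * _; nra.
Qed.

Section corner_cover.
Variable R : realType.
Variables s k : nat.
Hypothesis s0 : (0 < s)%N.

(** For the ratio [q] and the length [L], Bernoulli's inequality gives [1 - q ^ s <= 2 ^ -(k + 2)],
    and [L] is long enough for [q ^ L <= 2 ^ -(k + 2)]. *)
Definition cover_den := (2 ^ (k + 2))%N.
Definition cover_len := (s * (cover_den * (k + 2)))%N.
Definition cover_ratio : R := 1 - (s * cover_den)%:R^-1.

(* Exponent vectors [i] of the geometric grid; those with sum [cover_len] stand
   for boxes so small that the lower bracket can be taken empty. *)
Definition cover_index :=
  {i : {ffun 'I_s -> 'I_cover_len.+1} | (\sum_j i j <= cover_len)%N}.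

Definition extend0 (f : 'I_s -> R) (j : nat) : R :=
  if insub j is Some o then f o else 0.

Definition cover_up (i : cover_index) := extend0 (fun j => cover_ratio ^+ sval i j).

Definition cover_lo (i : cover_index) := extend0 (fun j =>
  if (\sum_j sval i j == cover_len)%N then 0 else cover_ratio ^+ (sval i j).+1).

Let extend0E f (j : 'I_s) : extend0 f j = f j.
Proof. by rewrite /extend0 valK. Qed.

Let extend0_in01 f : (forall j, 0 <= f j <= 1) -> in01 s (extend0 f).
Proof. by move=> f01 j js; rewrite -[j]/(val (Ordinal js)) extend0E. Qed.

Let den_gt0 : (0 < s * cover_den)%N.
Proof. by rewrite muln_gt0 s0 expn_gt0. Qed.

Let ratio01 : 0 <= cover_ratio <= 1.
Proof.
rewrite /cover_ratio subr_ge0 gerBl invr_ge0 ler0n andbT invf_le1 ?ltr0n//.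
by rewrite ler1n.
Qed.

Let ratioX01 n : 0 <= cover_ratio ^+ n <= 1.
Proof. by have /andP[q0 q1] := ratio01; rewrite exprn_ge0// exprn_ile1. Qed.

Lemma cover_up_in01 i : in01 s (cover_up i).
Proof. by apply: extend0_in01 => j. Qed.

Lemma cover_lo_in01 i : in01 s (cover_lo i).
Proof. by apply: extend0_in01 => j; case: ifP => // _; rewrite lexx ler01. Qed.

Lemma cover_lo_up i : le_on s (cover_lo i) (cover_up i).
Proof.
have /andP[q0 q1] := ratio01.
move=> j js; rewrite -[j]/(val (Ordinal js)) /cover_lo /cover_up !extend0E.
by case: ifP => _; rewrite ?exprn_ge0// exprS ler_piMl// exprn_ge0.
Qed.

(** Each coordinate gets the largest exponent [c <= L] with [x j <= q ^ c]. If these sum to less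
    than [L], they bracket [x]; otherwise they are lowered to the sum [L], which keeps the upper
    bounds and sets the lower corner to [0]. *)
Lemma cover_exists x : in01 s x ->
  exists i, le_on s (cover_lo i) x /\ le_on s x (cover_up i).
Proof.
move=> x01; have /andP[q0 q1] := ratio01.
pose q := cover_ratio; pose L := cover_len.
have /choice[c cP] : forall j : 'I_s, exists c : nat,
    [/\ (c <= L)%N, x j <= q ^+ c & ((c < L)%N -> q ^+ c.+1 <= x j)].
  move=> j; have /andP[xj0 xj1] := x01 _ (ltn_ord j).
  have ex : exists n, (n <= L)%N && (x j <= q ^+ n) by exists 0%N; rewrite expr0 xj1.
  have ub n : (n <= L)%N && (x j <= q ^+ n) -> (n <= L)%N by case/andP.
  case: (ex_maxnP ex ub) => c /andP[cL xc] cmax; exists c; split => // cltL.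
  rewrite leNgt; apply/negP => /ltW h.
  by have := cmax c.+1; rewrite cltL h ltnn => /(_ isT).
have [i [iL xi loi]] : exists i : 'I_s -> nat, [/\ (\sum_j i j <= L)%N,
    (forall j : 'I_s, x j <= q ^+ i j) &
    ((\sum_j i j)%N != L -> forall j : 'I_s, q ^+ (i j).+1 <= x j)].
  have [Lc|cL] := leqP L (\sum_j c j)%N.
    have [i ic iL] := exists_subvector_sum Lc.
    exists i; split; rewrite ?iL ?eqxx// => j.
    have [_ xj _] := cP j; apply: (le_trans xj).
    by rewrite ler_wiXn2l// ic.
  exists c; split => [|j|_ j]; rewrite ?(ltnW cL)//; have [c1 c2 c3] := cP j => //.
  (* A sum below [L] puts every single exponent below the cap [L], so its maximality yields the
     lower bound. *)
  by apply: c3; apply: leq_ltn_trans cL; rewrite (bigD1 j)//= leq_addr.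
have ile j : (i j <= L)%N by apply: leq_trans iL; rewrite (bigD1 j)//= leq_addr.
pose f := [ffun j => inord (i j) : 'I_L.+1].
have fE j : f j = i j :> nat by rewrite ffunE inordK// ltnS.
have fL : (\sum_j f j <= L)%N by under eq_bigr do rewrite fE.
exists (exist _ f fL); split=> j js; rewrite -[j]/(val (Ordinal js)).
  rewrite /cover_lo extend0E /=; under eq_bigr do rewrite fE.
  case: ifPn => h; first by have /andP[] := x01 _ (ltn_ord (Ordinal js)).
  by rewrite fE loi.
by rewrite /cover_up extend0E /= fE; exact: (xi (Ordinal js)).
Qed.

(** Each run of [s * cover_den] factors contributes at most [expR (- 1) <= 2^-1], and there are
    [k + 2] runs. *)
Let ratio_len : cover_ratio ^+ cover_len <= (2 ^+ (k + 2))^-1.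
Proof.
rewrite /cover_len mulnA exprM -exprVn lerXn2r ?nnegrE// ?exprn_ge0//; try by case/andP: ratio01.
have e2 : expR (- 1) <= 2^-1 :> R.
  by rewrite expRN lef_pV2 ?posrE ?expR_gt0//; apply: le_trans (expR_ge1Dx _).
apply: le_trans e2.
have -> : -1 = (s * cover_den)%:R * - (s * cover_den)%:R^-1 :> R.
  by rewrite mulrN mulfV// pnatr_eq0 -lt0n.
rewrite expRM_natl lerXn2r ?nnegrE ?expR_ge0//; first by case/andP: ratio01.
exact: expR_ge1Dx.
Qed.

Let ratio_bernoulli : 1 - cover_ratio ^+ s <= (2 ^+ (k + 2))^-1.
Proof.
have /andP[q0 q1] := ratio01.
have -> : (2 ^+ (k + 2))^-1 = s%:R * (1 - cover_ratio) :> R.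
  rewrite /cover_ratio opprB addrC subrK natrM invfM mulrA mulfV ?mul1r; last first.
    by rewrite pnatr_eq0 -lt0n.
  by rewrite /cover_den natrX.
exact: one_minus_exprn_le.
Qed.

(** At the maximal sum the lower product vanishes and the upper one is [q ^ L]; otherwise the
    difference is a power of [q] times [1 - q ^ s]. *)
Lemma cover_vol i :
  \prod_(j < s) cover_up i j - \prod_(j < s) cover_lo i j <= (2 ^+ (k + 2))^-1.
Proof.
have -> : \prod_(j < s) cover_up i j = cover_ratio ^+ (\sum_j sval i j)%N.
  by rewrite expr_sum; apply: eq_bigr => j _; rewrite /cover_up extend0E.
have [e|ne] := eqVneq (\sum_j sval i j)%N cover_len.
  have -> : \prod_(j < s) cover_lo i j = 0.
    rewrite (bigD1 (Ordinal s0))//= -[0%N]/(val (Ordinal s0)) /cover_lo extend0E.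
    by rewrite e eqxx mul0r.
  by rewrite subr0 e.
have -> : \prod_(j < s) cover_lo i j = cover_ratio ^+ (\sum_j sval i j)%N * cover_ratio ^+ s.
  rewrite -[X in _ * _ ^+ X]card_ord -sum1_card -exprD -big_split expr_sum.
  by apply: eq_bigr => j _; rewrite /cover_lo extend0E (negbTE ne) /= addn1.
apply: le_trans ratio_bernoulli; rewrite -[X in X - _]mulr1 -mulrBr.
have /andP[z0 z1] := ratioX01 (\sum_j sval i j)%N.
by rewrite ler_piMl// subr_ge0; case/andP: (ratioX01 s).
Qed.

(* Weighting each vector by [x ^ (sum i - L) >= 1] with [x = L / (L + s)] bounds
   their number by [x ^ (- L) (1 - x) ^ (- s)]. *)
Lemma card_cover_index :
  #|{: cover_index}|%:R <= (expR 1 * (1 + (k + 2)%:R * 2 ^+ (k + 2))) ^+ s :> R.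
Proof.
have L0 : (0 < cover_len)%N by rewrite !muln_gt0 s0 expn_gt0 addn2.
pose L : R := cover_len%:R; pose S : R := s%:R.
have LR0 : 0 < L by rewrite ltr0n.
have S0 : 0 < S by rewrite ltr0n.
pose x := L / (L + S).
have LS0 : 0 < L + S by rewrite addr_gt0.
have x0 : 0 < x by rewrite divr_gt0.
have x1 : x < 1 by rewrite ltr_pdivrMr// mul1r ltrDl.
have card_le : #|{: cover_index}|%:R * x ^+ cover_len <= (1 - x)^-1 ^+ s.
  rewrite card_sig -sum1_card natr_sum mulr_suml.
  (* Dropping the constraint on the sum turns the weighted count into a product of [s] geometric
     sums. *)
  apply: (@le_trans _ _ (\sum_(i : {ffun 'I_s -> 'I_cover_len.+1}) \prod_(j < s) x ^+ i j)).
    rewrite [leRHS](bigID (fun i : {ffun 'I_s -> 'I_cover_len.+1} => \sum_j i j <= cover_len)%N)/=.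
    rewrite -[leLHS]addr0 lerD ?sumr_ge0//; last first.
      by move=> i _; rewrite prodr_ge0// => j _; rewrite exprn_ge0// ltW.
    apply: ler_sum => i iL; rewrite mul1r -expr_sum ler_wiXn2l ?(ltW x0) ?(ltW x1)//.
  rewrite -(bigA_distr_bigA (fun _ (n : 'I_cover_len.+1) => x ^+ n)) prodr_const card_ord.
  have geo : \sum_(n < cover_len.+1) x ^+ n <= (1 - x)^-1.
    rewrite -div1r ler_pdivlMr ?subr_gt0// mulrC -opprB mulNr -subrX1 opprB gerBl.
    by rewrite exprn_ge0// ltW.
  by rewrite lerXn2r ?nnegrE ?sumr_ge0// ?invr_ge0 ?subr_ge0 ?(ltW x1)// => n _; rewrite exprn_ge0// ltW.
(* Here [1 / x = 1 + s / L], and [(1 + s / L) ^ L <= e ^ s]. *)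
have xL : (x ^+ cover_len)^-1 <= expR 1 ^+ s.
  rewrite -expRM_natl mulr1 -exprVn /x invf_div.
  have SE : s%:R = cover_len%:R * (S / L) by rewrite mulrC divfK// gt_eqF.
  rewrite SE expRM_natl lerXn2r ?nnegrE ?expR_ge0 ?divr_ge0 ?(ltW LR0) ?(ltW LS0)//.
  by rewrite mulrDl divff ?gt_eqF//; exact: expR_ge1Dx.
have -> : 1 + (k + 2)%:R * 2 ^+ (k + 2) = (1 - x)^-1.
  have LE : L = S * ((k + 2)%:R * 2 ^+ (k + 2)).
    by rewrite /L /S /cover_len /cover_den !natrM natrX; ring.
  rewrite /x -[X in X - _](@divff _ (L + S)) ?gt_eqF// -mulrBl addrAC subrr add0r invf_div.
  by rewrite mulrDl divff ?gt_eqF// addrC LE mulrAC divff ?gt_eqF// mul1r.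
rewrite exprMn -(ler_pM2r (exprn_gt0 cover_len x0)); apply: (le_trans card_le).
rewrite -mulrA mulrCA ler_peMr//; first by rewrite exprn_ge0// invr_ge0 subr_ge0 ltW.
by rewrite -ler_pdivrMr ?exprn_gt0// div1r.
Qed.
End corner_cover.

Section box_volume.
Variable R : realType.
Implicit Types a b : nat -> R.

Lemma box_vol_in01 s a b : in01 s a -> in01 s b -> 0 <= box_vol s a b <= 1.
Proof.
move=> a01 b01; rewrite /box_vol prodr_ge0/=; last by move=> j _; rewrite le_max lexx orbT.
apply: prodr_ile1 => j _; have /andP[? ?] := a01 _ (ltn_ord j).
have /andP[? ?] := b01 _ (ltn_ord j); rewrite le_max lexx orbT/= ge_max ler01 andbT; lra.
Qed.

Lemma le_box_vol s a b a' b' : le_on s a' a -> le_on s b b' -> box_vol s a b <= box_vol s a' b'.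
Proof.
move=> aa bb; apply: ler_prod => j _; rewrite le_max lexx orbT/=.
by rewrite ge_max !le_max lexx orbT andbT lerB ?aa ?bb.
Qed.

Lemma box_count_le s N pts a b a' b' : le_on s a' a -> le_on s b b' ->
  (box_count s N pts a b <= box_count s N pts a' b')%N.
Proof.
move=> aa bb; apply: leq_sum => i _; case: forallP => //= h.
case: forallP => // -[] j; have /andP[h1 h2] := h j.
by rewrite (le_trans (aa _ _) h1)//= (lt_le_trans h2)// bb.
Qed.

(** Induction on the dimension with [F f - G g = F (f - g) + (F - G) g]. The change [f - g] of the
    last side splits into the moves of its two ends; bounding [F] by either product and [g] by [b s]
    or [1 - a s] makes the two products telescope separately. *)
Lemma box_vol_diff s a b a' b' : in01 s a -> in01 s b -> in01 s a' -> in01 s b' ->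
  le_on s a' a -> le_on s b b' ->
  box_vol s a' b' - box_vol s a b <=
  (\prod_(j < s) b' j - \prod_(j < s) b j) +
  (\prod_(j < s) (1 - a' j) - \prod_(j < s) (1 - a j)).
Proof.
elim: s => [|s IH]; first by rewrite /box_vol !big_ord0 !subrr addr0.
move=> a1 b1 a1' b1' aa bb.
have w (P : nat -> Prop) : (forall j, (j < s.+1)%N -> P j) -> forall j, (j < s)%N -> P j.
  by move=> h j js; apply: h; rewrite ltnS ltnW.
have {}IH := IH (w _ a1) (w _ b1) (w _ a1') (w _ b1') (w _ aa) (w _ bb).
have [/andP[F0 F1] /andP[G0 G1]] := (box_vol_in01 (w _ a1') (w _ b1'), box_vol_in01 (w _ a1) (w _ b1)).
have GF := le_box_vol (w _ aa) (w _ bb).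
have FB : box_vol s a' b' <= \prod_(j < s) b' j.
  apply: ler_prod => j _; have js := ltnW (ltn_ord j).
  have /andP[? ?] := a1' j js; have /andP[? ?] := b1' j js.
  by rewrite le_max lexx orbT/= ge_max; apply/andP; split; lra.
have FA : box_vol s a' b' <= \prod_(j < s) (1 - a' j).
  apply: ler_prod => j _; have js := ltnW (ltn_ord j).
  have /andP[? ?] := a1' j js; have /andP[? ?] := b1' j js.
  by rewrite le_max lexx orbT/= ge_max; apply/andP; split; lra.
have BB : \prod_(j < s) b j <= \prod_(j < s) b' j.
  apply: ler_prod => j _; have js := ltnW (ltn_ord j).
  by have /andP[-> ?] := b1 j js; exact: bb.
have AA : \prod_(j < s) (1 - a j) <= \prod_(j < s) (1 - a' j).
  apply: ler_prod => j _; have js := ltnW (ltn_ord j).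
  have /andP[? ?] := a1 j js; have := aa j js; move=> ?; apply/andP; split; lra.
have /andP[? ?] := a1 s (ltnSn s); have /andP[? ?] := a1' s (ltnSn s).
have /andP[? ?] := b1 s (ltnSn s); have /andP[? ?] := b1' s (ltnSn s).
have as_ := aa s (ltnSn s); have bs_ := bb s (ltnSn s).
rewrite /box_vol !big_ord_recr/= -!/(box_vol s _ _).
set f := Num.max (b' s - a' s) 0; set g := Num.max (b s - a s) 0.
have g0 : 0 <= g by rewrite /g le_max lexx orbT.
have gb : g <= b s by rewrite /g ge_max; apply/andP; split; lra.
have ga : g <= 1 - a s by rewrite /g ge_max; apply/andP; split; lra.
have fg : f - g <= (b' s - b s) + (a s - a' s).
  rewrite lerBlDr /f ge_max; apply/andP; split.
    have : b s - a s <= g by rewrite /g le_max lexx.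
    lra.
  lra.
move: F0 GF IH FB FA BB AA; set F := box_vol s a' b'; set G := box_vol s a b.
set B' := \prod_(j < s) b' j; set B := \prod_(j < s) b j.
set A' := \prod_(j < s) (1 - a' j); set A := \prod_(j < s) (1 - a j).
move=> F0 GF IH FB FA BB AA.
have h1 := ler_wpM2l F0 fg.
have h2 : F * (b' s - b s) <= B' * (b' s - b s) by rewrite ler_wpM2r// subr_ge0.
have h3 : F * (a s - a' s) <= A' * (a s - a' s) by rewrite ler_wpM2r// subr_ge0.
have h4 := ler_wpM2r g0 IH.
have h5 : (B' - B) * g <= (B' - B) * b s by rewrite ler_wpM2l// subr_ge0.
have h6 : (A' - A) * g <= (A' - A) * (1 - a s) by rewrite ler_wpM2l// subr_ge0.
lra.
Qed.
End box_volume.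

Section box_cover.
Variable R : realType.
Variables (s k : nat).
Hypothesis s0 : (0 < s)%N.
Implicit Types a b : nat -> R.

Definition box_index : Type := (cover_index s k * cover_index s k)%type.

(** The lower corner [a] is bracketed through its reflection [1 - a], so that both corners use the
    same cover of boxes at the origin. The inner box may be empty; its volume is then [0]. *)
Definition inner_a (g : box_index) (j : nat) : R := 1 - cover_lo R g.1 j.
Definition inner_b (g : box_index) : nat -> R := cover_lo R g.2.
Definition outer_a (g : box_index) (j : nat) : R := 1 - cover_up R g.1 j.
Definition outer_b (g : box_index) : nat -> R := cover_up R g.2.

Let in01_oneB x : in01 s x -> in01 s (fun j => 1 - x j : R).
Proof. by move=> x01 j js; have /andP[? ?] := x01 j js; apply/andP; split; lra. Qed.

Lemma inner_a_in01 g : in01 s (inner_a g).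
Proof. by apply: in01_oneB; exact: cover_lo_in01. Qed.

Lemma inner_b_in01 g : in01 s (inner_b g).
Proof. exact: cover_lo_in01. Qed.

Lemma outer_a_in01 g : in01 s (outer_a g).
Proof. by apply: in01_oneB; exact: cover_up_in01. Qed.

Lemma outer_b_in01 g : in01 s (outer_b g).
Proof. exact: cover_up_in01. Qed.

Lemma outer_inner_a g : le_on s (outer_a g) (inner_a g).
Proof. by move=> j js; rewrite lerB//; exact: cover_lo_up. Qed.

Lemma inner_outer_b g : le_on s (inner_b g) (outer_b g).
Proof. exact: cover_lo_up. Qed.

Lemma box_index_vol g :
  box_vol s (outer_a g) (outer_b g) - box_vol s (inner_a g) (inner_b g) <= (2 ^+ k.+1)^-1.
Proof.
apply: (le_trans (box_vol_diff (inner_a_in01 g) (inner_b_in01 g) (outer_a_in01 g)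
  (outer_b_in01 g) (outer_inner_a g) (inner_outer_b g))).
have := cover_vol R s0 g.1; have := cover_vol R s0 g.2.
rewrite /outer_a /inner_a /outer_b /inner_b.
under [X in _ -> _ -> _ + (X - _) <= _]eq_bigr do rewrite subKr.
under [X in _ -> _ -> _ + (_ - X) <= _]eq_bigr do rewrite subKr.
have -> : (2 ^+ (k + 2))^-1 = (2 ^+ k.+1)^-1 / 2 :> R.
  by rewrite addn2 [in LHS]exprSr invfM.
lra.
Qed.

Definition brackets (g : box_index) a b :=
  [/\ le_on s (outer_a g) a, le_on s a (inner_a g), le_on s (inner_b g) b & le_on s b (outer_b g)].

(** The conditions on [a] and [b] stand under the existential so that [box_pick] is total; elsewhere
    some index for the point [0] is returned. *)
Lemma box_index_exists a b : exists g, in01 s a -> in01 s b -> brackets g a b.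
Proof.
have [h|h] := pselect (in01 s a /\ in01 s b); last first.
  have z01 : in01 s (fun=> 0 : R) by move=> j _; rewrite lexx ler01.
  have [i _] := cover_exists k s0 z01.
  by exists (i, i) => a01 b01; exfalso; apply: h.
have [i [lo up]] := cover_exists k s0 (in01_oneB h.1).
have [i' [lo' up']] := cover_exists k s0 h.2.
exists (i, i') => _ _; split=> //= j js.
  by rewrite /outer_a/= lerBlDr addrC -lerBlDr up.
by rewrite /inner_a/= lerBrDr addrC -lerBrDr lo.
Qed.

Definition box_pick a b : box_index := projT1 (cid (box_index_exists a b)).

Lemma box_pickP a b : in01 s a -> in01 s b -> brackets (box_pick a b) a b.
Proof. by rewrite /box_pick; case: cid. Qed.

Lemma card_box_index :
  #|{: box_index}|%:R <= (expR 1 * (1 + (k + 2)%:R * 2 ^+ (k + 2))) ^+ (2 * s) :> R.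
Proof.
by rewrite card_prod natrM mul2n -addnn exprD ler_pM//; exact: card_cover_index.
Qed.

End box_cover.

(** * Chaining through nested brackets *)

Section chaining.
Variables (R : realType) (s N K : nat) (pts : nat -> nat -> R) (tau : nat -> R).
Hypothesis s0 : (0 < s)%N.

Let D a b := box_dev s N pts a b.

Definition chain_parent k (g : box_index s k.+1) : box_index s k :=
  box_pick k s0 (inner_a R g) (inner_b R g).

Hypothesis dev_base : forall g : box_index s 0,
  `|D (inner_a R g) (inner_b R g) - D (fun=> 1) (fun=> 0)| <= tau 0.
Hypothesis dev_step : forall k (g : box_index s k.+1), (k < K)%N ->
  `|D (inner_a R g) (inner_b R g) -
    D (inner_a R (chain_parent g)) (inner_b R (chain_parent g))| <= tau k.+1.
Hypothesis dev_last : forall g : box_index s K,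
  `|D (outer_a R g) (outer_b R g) - D (inner_a R g) (inner_b R g)| <= tau K.+1.

(** The chain starts at the empty box with lower corner [1] and upper corner [0]. *)
Let dev_empty : D (fun=> 1) (fun=> 0) = 0.
Proof.
rewrite /D /box_dev /box_count /box_vol big1 => [|i _].
  by rewrite (bigD1 (Ordinal s0))//= max_r ?subr_le0// mul0r mulr0 subrr.
apply/eqP; rewrite eqb0; apply/forallPn; exists (Ordinal s0).
by rewrite negb_and -leNgt; case: leP => //= h; rewrite (le_trans ler01).
Qed.

(** Telescoping along parents bounds inner boxes of level [K], and one more link bounds the outer
    ones. Counts are monotone, so the deviation of any box lies between those two up to [N] times
    the bracket volume. *)
Lemma chaining a b : in01 s a -> in01 s b ->
  `|D a b| <= \sum_(k < K.+2) tau k + N%:R * (2 ^+ K.+1)^-1.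
Proof.
have inner k : (k <= K)%N -> forall g : box_index s k,
    `|D (inner_a R g) (inner_b R g)| <= \sum_(i < k.+1) tau i.
  elim: k => [|k IH] kK g.
    by rewrite big_ord1; have := dev_base g; rewrite dev_empty subr0.
  rewrite big_ord_recr/= -[X in `|X|](subrK (D (inner_a R (chain_parent g)) (inner_b R (chain_parent g)))).
  rewrite addrC; apply: (le_trans (ler_normD _ _)); rewrite lerD ?IH ?(ltnW kK)//.
  exact: dev_step.
move=> a01 b01; have [oa ai ib bo] := box_pickP K s0 a01 b01.
set g := box_pick K s0 a b in oa ai ib bo.
rewrite big_ord_recr/=.
have := inner K (leqnn K) g; set S := \sum_(i < K.+1) _; have := dev_last g.
have := box_index_vol R s0 g.
have := le_box_vol ai ib; have := le_box_vol oa bo.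
have := box_count_le N pts ai ib; have := box_count_le N pts oa bo.
rewrite -!(ler_nat R) /D /box_dev.
set c := (box_count _ _ _ a b)%:R; set ci := (box_count _ _ _ (inner_a _ _) _)%:R.
set co := (box_count _ _ _ (outer_a _ _) _)%:R.
set v := box_vol _ a b; set vi := box_vol _ (inner_a _ _) _; set vo := box_vol _ (outer_a _ _) _.
set e := (2 ^+ K.+1)^-1 => cco cic vvo viv voi.
have n0 : 0 <= N%:R :> R by [].
have h1 : N%:R * (vo - v) <= N%:R * e by rewrite ler_wpM2l//; lra.
have h2 : N%:R * (v - vi) <= N%:R * e by rewrite ler_wpM2l//; lra.
rewrite !ler_norml => /andP[? ?] /andP[? ?]; apply/andP; split; lra.
Qed.

End chaining.

(** * The constants *)

Section constants.
Variable R : realType.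
Implicit Types k s : nat.

(* [exp (s * entropy k s)] is the allowance for the number of brackets at level [k]. *)
Definition entropy k s : R :=
  ln (Cconst R s ^+ 2 / pi * 2 ^+ (k + 2)) / s%:R + 2 * ln (2 * expR 1 * (2 ^+ (k + 2) + 1)).

Lemma acoefE k s : acoef R k s = bcoef R k * entropy k s.
Proof. by []. Qed.

Lemma ln2X n : ln (2 ^+ n) = n%:R * ln 2 :> R.
Proof. by rewrite lnXn// mulr_natl. Qed.

Let two_gt0 n : 0 < 2 ^+ n :> R. Proof. by rewrite exprn_gt0. Qed.

Let C_ge1 s : 1 <= Cconst R s.
Proof. by rewrite /Cconst le_max lexx. Qed.

Let C_gt0 s : 0 < Cconst R s.
Proof. exact: lt_le_trans ltr01 (C_ge1 s). Qed.

Let lnC_le s : ln (Cconst R s) <= s%:R / 10.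
Proof.
have h : ln (11 / 10) <= 1 / 10 :> R.
  have -> : 11 / 10 = 1 + 1 / 10 :> R by lra.
  by apply: le_ln1Dx; lra.
rewrite /Cconst /Num.max; case: ifP => _; last by rewrite ln1 divr_ge0.
rewrite ln_powR; have l0 : 0 <= ln (11 / 10) :> R by rewrite ln_ge0//; lra.
have s0 : 0 <= s%:R :> R by [].
set l := ln _ in h l0 *; set S := s%:R in s0 *; nra.
Qed.

Let ln_bracket k : ln (2 * expR 1 * (2 ^+ (k + 2) + 1)) = ln 2 + 1 + ln (2 ^+ (k + 2) + 1) :> R.
Proof.
have e0 : 0 < expR 1 :> R by exact: expR_gt0.
by rewrite !lnM ?posrE ?mulr_gt0 ?addr_gt0// expRK.
Qed.

Let pi_lt4 : pi < 4 :> R.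
Proof. have := pihalf_lt2 R; lra. Qed.

Let first_term k s : ln (Cconst R s ^+ 2 / pi * 2 ^+ (k + 2)) =
  2 * ln (Cconst R s) + (ln 4 - ln pi) + k%:R * ln 2.
Proof.
have p0 := pi_gt0 R; have C0 := C_gt0 s.
have p1 : 0 < pi^-1 :> R by rewrite invr_gt0.
rewrite lnM ?posrE ?divr_gt0 ?exprn_gt0// lnM ?posrE ?exprn_gt0// lnV ?posrE// lnXn// ln2X.
have -> : 4 = 2 ^+ 2 :> R by lra.
by rewrite ln2X natrD !mulr_natl; ring.
Qed.

Let ln4pi_ge0 : 0 <= ln 4 - ln pi :> R.
Proof. by rewrite subr_ge0 ler_ln ?posrE ?pi_gt0// ltW. Qed.

Let ln4pi_le : ln 4 - ln pi <= ln 2 :> R.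
Proof.
have -> : 4 = 2 * 2 :> R by lra.
have : ln 2 <= ln pi :> R by rewrite ler_ln ?posrE ?pi_gt0// pi_ge2.
rewrite lnM ?posrE//; lra.
Qed.

Let lnC_ge0 s : 0 <= ln (Cconst R s).
Proof. exact: ln_ge0. Qed.

Lemma entropy_ge k s : (0 < s)%N -> 2 * (1 + (k + 3)%:R * ln 2) <= entropy k s.
Proof.
move=> s0; rewrite /entropy first_term ln_bracket.
have l0 := ln2_ge R.
have h : (k + 2)%:R * ln 2 <= ln (2 ^+ (k + 2) + 1) :> R.
  by rewrite -ln2X ler_ln ?posrE ?addr_gt0// lerDl.
have := ln4pi_ge0; have := lnC_ge0 s => C0 p0.
have f0 : 0 <= (2 * ln (Cconst R s) + (ln 4 - ln pi) + k%:R * ln 2) / s%:R.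
  have kl : 0 <= k%:R * ln 2 :> R by rewrite mulr_ge0//; lra.
  by apply: divr_ge0 => //; lra.
move: h f0; rewrite !natrD; set l := ln 2; set x := _ / s%:R; lra.
Qed.

(** With [ln C_s <= s / 10], [ln (4 / pi) <= ln 2] and [ln 2 <= 7 / 10] the total is at most
    [27 / 10 + (3 k + 7) * 7 / 10]. *)
Lemma entropy_le k s : (0 < s)%N -> entropy k s <= 38 / 5 + 21 / 10 * k%:R.
Proof.
move=> s0; rewrite /entropy first_term ln_bracket.
have l0 := ln2_ge R; have l1 := ln2_le R.
have h : ln (2 ^+ (k + 2) + 1) <= (k + 2)%:R * ln 2 + 1 / 4 :> R.
  have -> : 2 ^+ (k + 2) + 1 = 2 ^+ (k + 2) * (1 + (2 ^+ (k + 2))^-1) :> R.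
    by rewrite mulrDr mulr1 mulfV// gt_eqF.
  have i0 : 0 <= (2 ^+ (k + 2))^-1 :> R by rewrite invr_ge0 ltW.
  rewrite lnM ?posrE ?ltr_wpDr// ln2X lerD2l; apply: (le_trans (le_ln1Dx _)).
    exact: lt_le_trans i0.
  rewrite div1r lef_pV2 ?posrE//; have -> : 4 = 2 ^+ 2 :> R by lra.
  by rewrite ler_eXn2l ?ltr1n// leq_addl.
have s1 : 1 <= s%:R :> R by rewrite ler1n.
have f : (2 * ln (Cconst R s) + (ln 4 - ln pi) + k%:R * ln 2) / s%:R <=
    1 / 5 + (k%:R + 1) * ln 2.
  rewrite ler_pdivrMr ?ltr0n//.
  have := lnC_le s; have := ln4pi_le; have k0 : 0 <= k%:R :> R by [].
  move: s1 l0; set S := s%:R; set x := ln (Cconst _ _); set l := ln 2; set p := ln 4 - _.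
  set K := k%:R in k0 *; move=> s1 l0 pl xS; have Kl : 0 <= (K + 1) * l by nra.
  have := ler_wpM2l Kl s1; lra.
have kl : k%:R * ln 2 <= k%:R * (7 / 10) :> R by rewrite ler_wpM2l.
move: h f; rewrite !natrD; set x := _ / s%:R; set y := ln (_ + 1). lra.
Qed.

(** The last link of the chain is indexed by brackets of level [K] but estimated at level [K.+1]. *)
Lemma entropy_step k s : (0 < s)%N -> entropy k s <= entropy k.+1 s.
Proof.
move=> s0; rewrite /entropy !first_term !ln_bracket lerD//.
  rewrite ler_wpM2r ?invr_ge0// lerD2l ler_wpM2r ?ler_nat//; have := ln2_ge R; lra.
rewrite ler_wpM2l// lerD2l ler_ln ?posrE ?addr_gt0// lerD2r ler_eXn2l ?ltr1n//.
Qed.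

Lemma entropy_le_entropy0 k s : (0 < s)%N -> entropy k s <= entropy 0 s + 21 / 10 * k%:R.
Proof.
move=> s0; rewrite /entropy !first_term !ln_bracket.
have l0 := ln2_ge R; have l1 := ln2_le R.
have h : ln (2 ^+ (k + 2) + 1) <= k%:R * ln 2 + ln (2 ^+ (0 + 2) + 1) :> R.
  rewrite -ln2X -lnM ?posrE ?addr_gt0// ler_ln ?posrE ?mulr_gt0 ?addr_gt0//.
  by rewrite mulrDr mulr1 -exprD addnC lerD2l exprn_ege1//; lra.
have s1 : 1 <= s%:R :> R by rewrite ler1n.
have : (2 * ln (Cconst R s) + (ln 4 - ln pi) + k%:R * ln 2) / s%:R <=
  (2 * ln (Cconst R s) + (ln 4 - ln pi) + 0%:R * ln 2) / s%:R + k%:R * ln 2.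
  rewrite mul0r addr0 mulrDl lerD2l ler_pdivrMr ?ltr0n// ler_peMr// mulr_ge0//; lra.
have kl : k%:R * ln 2 <= k%:R * (7 / 10) :> R by rewrite ler_wpM2l.
move: h; set x := _ / s%:R; set x' := _ / s%:R; set y := ln (_ + 1); set y' := ln (_ + 1); lra.
Qed.
End constants.

Section chaining_constants.
Variables (R : realType) (s : nat).
Hypothesis s0 : (0 < s)%N.
Implicit Types k : nat.

Lemma entropy_ge6 k : 6 <= entropy R k s.
Proof.
apply: le_trans (entropy_ge R k s0); have l := ln2_ge R.
have k0 : 0 <= k%:R :> R by [].
rewrite natrD; move: l; set l := ln 2; set K := k%:R in k0 *; nra.
Qed.

Let pow2 k : 0 < 2 ^+ k :> R. Proof. by rewrite exprn_gt0. Qed.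

Let half_le1 k : (2 ^+ k)^-1 <= 1 :> R.
Proof. by rewrite invf_le1// exprn_ege1// ler1n. Qed.

Lemma bcoef_ge0 k : 0 <= bcoef R k.
Proof. by rewrite /bcoef; case: ifP => // _; rewrite mulr_ge0 ?divr_ge0 ?exprn_ge0// subr_ge0. Qed.

Lemma acoef_ge0 k : 0 <= acoef R k s.
Proof. by rewrite acoefE mulr_ge0 ?bcoef_ge0// (le_trans _ (entropy_ge6 k)). Qed.

Lemma acoef0_ge : 18 <= acoef R 0 s.
Proof. by rewrite acoefE /bcoef/=; have := entropy_ge6 0; lra. Qed.

Let bcoef_le k : bcoef R k.+1 <= 8 / 2 ^+ k.+1.
Proof.
have -> : 8 = 2 ^+ 3 :> R by lra.
by rewrite /bcoef/= ler_piMr ?divr_ge0 ?exprn_ge0// gerBl invr_ge0 exprn_ge0.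
Qed.

(** The decay of [bcoef] beats the linear growth of the entropy: the values [3, 2, 3 / 2] are
    checked directly, later ones through [8 k <= 3 * 2 ^ k]. Thus no threshold exceeds the one of
    level [0]. *)
Lemma acoef_le_acoef0 k : acoef R k s <= acoef R 0 s.
Proof.
have L0 := entropy_ge6 0.
case: k => [//|[|[|k]]]; have := entropy_le_entropy0 R _ s0.
- move=> /(_ 1%N); rewrite !acoefE /bcoef/= expr1; lra.
- move=> /(_ 2%N); rewrite !acoefE /bcoef/=; lra.
move=> /(_ k.+3); rewrite !acoefE => Lk.
apply: (le_trans (ler_wpM2r _ (bcoef_le _))); first exact: le_trans (entropy_ge6 _).
rewrite /bcoef/=.
have k2 : 8 * k.+3%:R <= 3 * 2 ^+ k.+3 :> R.
  elim: (k) => [|n IH]; first by lra.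
  rewrite exprS -[n.+4%:R]natr1 mulrDr mulr1.
  have : 3 * 2 ^+ 3 <= 3 * 2 ^+ n.+3 :> R by rewrite ler_pM2l// ler_eXn2l// ltr1n.
  by move: IH; set x := n.+3%:R; set y := 2 ^+ n.+3; lra.
have e8 : 8 <= 2 ^+ k.+3 :> R.
  have -> : 8 = 2 ^+ 3 :> R by lra.
  by rewrite ler_eXn2l// ltr1n.
rewrite mulrAC ler_pdivrMr//.
move: e8 k2 Lk L0; set x := 2 ^+ k.+3; set K := k.+3%:R; set L := entropy _ _ _.
set L' := entropy _ _ _ => e8 k2 Lk L0; nra.
Qed.

Let sqrt_acoef_tail k : Num.sqrt (acoef R k.+2 s) <= 9 * (3 / 4) ^+ k.+2.
Proof.
have z0 : 0 <= 9 * (3 / 4) ^+ k.+2 :> R by rewrite mulr_ge0// exprn_ge0//; lra.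
rewrite -(ger0_norm z0) -sqrtr_sqr ler_wsqrtr//.
rewrite acoefE.
apply: (le_trans (ler_wpM2r _ (bcoef_le _))); first exact: le_trans (entropy_ge6 _).
have := entropy_le R k.+2 s0; set L := entropy _ _ _ => LE.
(* The square of the geometric majorant, multiplied by [2 ^ k], grows like [(9 / 8) ^ k]; four cases
   are numerical and the rest follow from Bernoulli's inequality. *)
have main : 8 * (38 / 5 + 21 / 10 * k.+2%:R) <= 81 * (9 / 8) ^+ k.+2 :> R.
  case: (k) => [|[|[|[|n]]]]; rewrite ?expr2 ?exprS ?expr1 ?expr0; try by lra.
  have h : 1 + n%:R / 8 <= (9 / 8) ^+ n :> R.
    elim: n => [|n IH]; first by rewrite expr0 mul0r addr0.
    rewrite exprS -[n.+1%:R]natr1; have n0 : 0 <= n%:R :> R by [].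
    move: IH n0; set x := (9 / 8) ^+ n; set y := n%:R; lra.
  have -> : n.+4.+2%:R = n%:R + 6 :> R by rewrite -natrD addnC.
  by move: h; have n0 : 0 <= n%:R :> R by []; set x := (9 / 8) ^+ n; move: n0; set y := n%:R; lra.
rewrite mulrAC ler_pdivrMr//.
have -> : (9 * (3 / 4) ^+ k.+2) ^+ 2 * 2 ^+ k.+2 = 81 * (9 / 8) ^+ k.+2 :> R.
  have -> : 9 / 8 = (3 / 4) ^+ 2 * 2 :> R by lra.
  by rewrite [in RHS]exprMn -[in RHS]exprM [in RHS]mulnC [in RHS]exprM; ring.
by apply: le_trans main; rewrite ler_wpM2l.
Qed.

Let sqrt_acoef0_le : Num.sqrt (acoef R 0 s) <= 478 / 100.
Proof.
have z : 0 <= 478 / 100 :> R by lra.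
rewrite -(ger0_norm z) -sqrtr_sqr ler_wsqrtr// acoefE /bcoef/=.
have := entropy_le R 0 s0; lra.
Qed.

Let psum M : R := \sum_(0 <= k < M) Num.sqrt (acoef R k s).

Let psum_le M : psum M <= 2944 / 100.
Proof.
suff h : psum M.+2 <= 2944 / 100 - 81 / 4 * (3 / 4) ^+ M.
  apply: (@le_trans _ _ (psum M.+2)).
    by rewrite /psum !big_nat_recr//= -addrA lerDl addr_ge0 ?sqrtr_ge0.
  by apply: (le_trans h); rewrite gerBl mulr_ge0// exprn_ge0//; lra.
elim: M => [|M IH].
  rewrite /psum !big_nat_recr//= big_nil add0r expr0.
  have s0' := sqrt_acoef0_le.
  have s1' : Num.sqrt (acoef R 1 s) <= 441 / 100.
    have z : 0 <= 441 / 100 :> R by lra.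
    rewrite -(ger0_norm z) -sqrtr_sqr ler_wsqrtr// acoefE /bcoef/=.
    have := entropy_le R 1 s0; rewrite expr1; lra.
  lra.
rewrite /psum big_nat_recr//= -/(psum M.+2).
have := sqrt_acoef_tail M; rewrite !exprS.
move: IH; set x := (3 / 4) ^+ M; set y := psum _; set z := Num.sqrt _; lra.
Qed.

Let psum_nd : nondecreasing_seq psum.
Proof.
apply/nondecreasing_seqP => n.
by rewrite /psum big_nat_recr//= lerDl sqrtr_ge0.
Qed.

Let psum_cvg : cvgn psum.
Proof.
apply: nondecreasing_is_cvgn => //.
by exists (2944 / 100) => _ [n _ <-]; exact: psum_le.
Qed.

Definition chain_sum : R := Num.sqrt (acoef R 0 s) + limn psum.

Lemma AconstE : Aconst R s = 2 * chain_sum ^+ 2.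
Proof. by []. Qed.

Lemma chain_sum_ge M :
  Num.sqrt (acoef R 0 s) + \sum_(k < M) Num.sqrt (acoef R k s) <= chain_sum.
Proof.
rewrite -(big_mkord xpredT (fun k => Num.sqrt (acoef R k s))) lerD2l.
exact: nondecreasing_cvgn_le.
Qed.

Lemma chain_sum_le : chain_sum <= 3422 / 100.
Proof.
have l : limn psum <= 2944 / 100.
  by apply: limr_le => //; apply: nearW => n; exact: psum_le.
have := sqrt_acoef0_le.
by rewrite /chain_sum; lra.
Qed.

Lemma chain_sum_ge2 : 2 * Num.sqrt (acoef R 0 s) <= chain_sum.
Proof. by have := chain_sum_ge 1; rewrite big_ord1; lra. Qed.

(** This is [2 * 34.22 ^ 2], rounded up. The union bound over blocks relies on a value well below
    [2548]. *)
Lemma Aconst_le : Aconst R s <= 2345.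
Proof.
rewrite AconstE; have := chain_sum_le; have := chain_sum_ge2.
by have := sqrtr_ge0 (acoef R 0 s); set x := Num.sqrt _; set y := chain_sum; nra.
Qed.

Lemma Aconst_ge : 8 * acoef R 0 s <= Aconst R s.
Proof.
rewrite AconstE; have := chain_sum_ge2; rewrite -[X in 8 * X <= _]sqr_sqrtr ?acoef_ge0//.
by have := sqrtr_ge0 (acoef R 0 s); set x := Num.sqrt _; set y := chain_sum; nra.
Qed.

End chaining_constants.

(** * Chaining within a dyadic block *)

Section level_estimates.
Variables (R : realType) (s : nat).
Hypothesis s0 : (0 < s)%N.
Implicit Types k : nat.

(** The cover exceeds [(2 e (2 ^ (k + 2) + 1)) ^ (2 s)] by roughly a power of [k + 2]; the exponent
    [3 / 2] absorbs this, because the base [x] of the cover and the base [z] of the entropy satisfy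
    [x ^ 2 <= z ^ 3]. *)
Lemma card_box_index_entropy k :
  #|{: box_index s k}|%:R <= expR (3 / 2 * (entropy R k s * s%:R)) :> R.
Proof.
apply: (le_trans (card_box_index R k s0)).
set w : R := 2 ^+ (k + 2); set e := expR 1.
have w0 : 0 < w by rewrite exprn_gt0.
have e2 : 2 <= e by apply: le_trans (expR_ge1Dx _); lra.
have x0 : 0 < e * (1 + (k + 2)%:R * w).
  by rewrite mulr_gt0 ?expR_gt0// ltr_pwDl// mulr_ge0// ltW.
have z0 : 0 < 2 * e * (w + 1) by rewrite !mulr_gt0 ?expR_gt0// addr_gt0.
have c2 : (k + 2)%:R ^+ 2 <= 8 * w.
  (* The summand [3] closes the induction, since [2 c + 1 <= c ^ 2 + 3]. *)
  suff : (k + 2)%:R ^+ 2 + 3 <= 8 * w by lra.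
  rewrite /w; elim: (k) => [|n IH]; first by lra.
  rewrite addSn [2 ^+ _.+1]exprS -[(n + 2).+1%:R]natr1; move: IH.
  set c := (n + 2)%:R; set v := 2 ^+ (n + 2); nra.
have xz : (e * (1 + (k + 2)%:R * w)) ^+ 2 <= (2 * e * (w + 1)) ^+ 3.
  have c1 : 1 <= (k + 2)%:R :> R by rewrite ler1n addn2.
  apply: (@le_trans _ _ ((e * ((k + 2)%:R * (w + 1))) ^+ 2)).
    rewrite lerXn2r ?nnegrE ?(ltW x0)//; first by rewrite !mulr_ge0// ?(le_trans _ e2)// addr_ge0// ltW.
    by rewrite ler_wpM2l ?(le_trans _ e2)//; lra.
  have -> : (e * ((k + 2)%:R * (w + 1))) ^+ 2 = (e * (w + 1)) ^+ 2 * (k + 2)%:R ^+ 2 by ring.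
  have -> : (2 * e * (w + 1)) ^+ 3 = (e * (w + 1)) ^+ 2 * (8 * (e * (w + 1))) by ring.
  rewrite ler_wpM2l ?sqr_ge0//; apply: (le_trans c2); nra.
rewrite -ler_ln ?posrE ?exprn_gt0 ?expR_gt0// expRK lnXn//.
have : ln (e * (1 + (k + 2)%:R * w)) <= 3 / 2 * ln (2 * e * (w + 1)).
  move: xz; rewrite -ler_ln ?posrE ?exprn_gt0// !lnXn//; lra.
rewrite -[ln _ *+ _]mulr_natl natrM /entropy -/w -/e.
set X := ln (e * _); set Z := ln (2 * _ * _); set Y := ln _ => XZ.
have Y0 : 0 <= Y.
  rewrite /Y ln_ge0// mulrAC ler_pdivlMr ?pi_gt0// mul1r.
  have C1 : 1 <= Cconst R s ^+ 2 by rewrite exprn_ege1// /Cconst le_max lexx.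
  have w4 : 4 <= w.
    have -> : 4 = 2 ^+ 2 :> R by lra.
    by rewrite /w ler_eXn2l ?ltr1n// leq_addl.
  have := pihalf_lt2 R; nra.
have S1 : 0 < s%:R :> R by rewrite ltr0n.
have -> : 3 / 2 * ((Y / s%:R + 2 * Z) * s%:R) = 3 / 2 * Y + 3 * Z * s%:R.
  by field; rewrite gt_eqF.
have := ler_wpM2r (ltW S1) XZ; set S := s%:R; lra.
Qed.

(** The weight of a block involves [ln (m + 1)], its rate only [ln m]. The claim is
    [(m + 1) ^ 8 <= m ^ 9], and [(8 / 7) ^ 8 <= 3]. *)
Lemma ln_succ_le (m : nat) : (7 <= m)%N -> ln m.+1%:R <= 9 / 8 * ln m%:R :> R.
Proof.
move=> m7; have m0 : 0 < m%:R :> R by rewrite ltr0n (leq_trans _ m7).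
suff : ln (m.+1%:R ^+ 8) <= ln (m%:R ^+ 9) :> R.
  rewrite lnXn ?ltr0Sn// lnXn// -[_ *+ 8]mulr_natl -[_ *+ 9]mulr_natl.
  set x := ln m.+1%:R; set y := ln m%:R; lra.
rewrite ler_ln ?posrE ?exprn_gt0 ?ltr0Sn//.
have mR : 7 <= m%:R :> R by rewrite (ler_nat _ 7).
have h : (m.+1%:R / m%:R) ^+ 8 <= 3 :> R.
  have q : m.+1%:R / m%:R <= 8 / 7 :> R.
    by rewrite ler_pdivrMr// -natr1; lra.
  apply: (le_trans (lerXn2r 8 _ _ q)); rewrite ?nnegrE ?divr_ge0//; lra.
move: h; rewrite expr_div_n ler_pdivrMr ?exprn_gt0// => /le_trans; apply.
by rewrite [leRHS]exprS ler_wpM2r ?exprn_ge0 ?ltW//; lra.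
Qed.

(* The variance bounds: [bcoef R k = 8 * varbound k] for [k > 0]. *)
Definition varbound k : R := if k == 0%N then 1 / 4 else (2 ^+ k)^-1 * (1 - (2 ^+ k)^-1).

Lemma varbound_gt0 k : 0 < varbound k.
Proof.
rewrite /varbound; case: k => [|k]/=; first by lra.
by rewrite mulr_gt0 ?invr_gt0 ?exprn_gt0// subr_gt0 invf_lt1 ?exprn_gt0// exprn_egt1// ltr1n.
Qed.

Lemma varboundP k (p : R) : 0 <= p <= 1 -> p <= (2 ^+ k)^-1 -> p * (1 - p) <= varbound k.
Proof.
move=> /andP[p0 p1]; rewrite /varbound; case: k => [|k]/=.
  by move=> _; have := sqr_ge0 (p - 1 / 2); nra.
have : (2 ^+ k.+1)^-1 <= 1 / 2 :> R.
  by rewrite div1r lef_pV2 ?posrE ?exprn_gt0// -[leLHS]expr1 ler_eXn2l// ltr1n.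
by set x := _^-1; nra.
Qed.

(** The quotient is [12] times the entropy at level [0] and [8] times it above;
    [22 / 3 = 2 (1 + 4 * 2 / 3)] bounds the entropy from level [1] on. *)
Lemma acoef_varbound k : 8 * (22 / 3) <= acoef R k s / varbound k /\
  8 * entropy R k s <= acoef R k s / varbound k.
Proof.
have [V0 L] := (varbound_gt0 k, entropy_ge R k s0); have l := ln2_ge R.
have L6 := entropy_ge6 R s0 k.
have -> : acoef R k s / varbound k = (if k == 0%N then 12 else 8) * entropy R k s.
  rewrite acoefE /bcoef; move: V0; rewrite /varbound; case: eqP => [_|_] V0; first by lra.
  have -> : 2 ^+ 3 / 2 ^+ k * (1 - (2 ^+ k)^-1) = 8 * ((2 ^+ k)^-1 * (1 - (2 ^+ k)^-1)) :> R by ring.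
  by rewrite mulrAC mulfK// gt_eqF.
case: k V0 L L6 => [|k] V0 L L6 /=; first by split; lra.
split=> //; rewrite ler_pM2l//; apply: le_trans L.
have k0 : 0 <= k%:R :> R by [].
rewrite addSn -[(k + 3).+1%:R]natr1 natrD; move: l k0; set x := ln 2; set K := k%:R; nra.
Qed.

End level_estimates.

Section block_estimates.
Variables (R : realType) (alpha beta : R) (s m : nat).
Hypothesis s0 : (0 < s)%N.
Hypothesis alpha1 : 1 < alpha.
Hypothesis beta1 : 1 < beta.

Definition block_rate : R := alpha * Aconst R s * s%:R + beta * Bconst R * ln m%:R.

Let M : nat := (2 ^ m.+1)%N.
Hypothesis rate_small : block_rate < M%:R.

Let A := Aconst R s.
Let y := block_rate / A.

Definition block_weight : R := s.+1%:R `^ (- alpha) * m.+1%:R `^ (- beta).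

Definition threshold k : R := Num.sqrt (acoef R k s * (M%:R * y)).

Let A_ge : 144 <= A.
Proof. by apply: le_trans (Aconst_ge R s0); have := acoef0_ge R s0; lra. Qed.

Let lnm_ge0 : 0 <= ln m%:R :> R.
Proof. by case: m => [|n]; [rewrite ln0|rewrite ln_ge0// ler1n]. Qed.

Let s1 : 1 <= s%:R :> R. Proof. by rewrite ler1n. Qed.

Let rate_ge : A <= block_rate.
Proof.
have a1 : 1 <= alpha * s%:R by rewrite -[leLHS]mulr1 ler_pM// ltW.
have b0 : 0 <= beta * Bconst R * ln m%:R.
  by rewrite /Bconst !mulr_ge0// (le_trans ler01 (ltW beta1)).
rewrite /block_rate -/A; have := ler_wpM2l (le_trans _ A_ge) a1; move=> /(_ (ler0n _ _)); lra.
Qed.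

(** The rate is at least [A >= 144], which exceeds [2 ^ 7]. *)
Lemma block_ge7 : (7 <= m)%N.
Proof.
rewrite leqNgt; apply/negP => m7.
have : M%:R <= 128 :> R by rewrite (ler_nat _ _ 128) (leq_pexp2l (m := 2) (n1 := m.+1) (n2 := 7)).
by have := rate_ge; have := A_ge; move: rate_small; lra.
Qed.

Let y_ge1 : 1 <= y.
Proof. by rewrite ler_pdivlMr ?mul1r//; apply: lt_le_trans A_ge. Qed.

Lemma threshold_sq k : threshold k ^+ 2 = acoef R k s * (M%:R * y).
Proof. by rewrite sqr_sqrtr// mulr_ge0 ?acoef_ge0// mulr_ge0// (le_trans ler01). Qed.

(** Since [y = alpha s + beta (178 / A) ln m], the exponent splits: the first part pays for the
    cardinality, the level and [s], the second for [m]. *)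
Lemma level_probability k (num : R) : 0 <= num <= expR (3 / 2 * (entropy R k s * s%:R)) ->
  num * (2 * expR (- (43 / 160 * (threshold k ^+ 2 / (M%:R * varbound R k))))) <=
  (2 ^+ k.+1)^-1 * block_weight.
Proof.
move=> /andP[n0 nE].
have M0 : 0 < M%:R :> R by rewrite ltr0n expn_gt0.
have [W1 W2] := acoef_varbound R s0 k.
have A0 : 0 < A by apply: lt_le_trans A_ge.
have V0 := varbound_gt0 R k.
have -> : threshold k ^+ 2 / (M%:R * varbound R k) = acoef R k s / varbound R k * y.
  by rewrite threshold_sq; field; rewrite !gt_eqF.
move: W1 W2; set W := acoef R k s / _ => W1 W2.
(* The factor [2] of the two-sided bound is matched by shifting the exponent to [k + 2]. *)
have -> : (2 ^+ k.+1)^-1 * block_weight = 2 * expR (- ((k + 2)%:R * ln 2)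
    - alpha * ln s.+1%:R - beta * ln m.+1%:R).
  rewrite !expRD /block_weight /powR !pnatr_eq0 /= !mulNr !mulrA; congr (_ * _ * _).
  rewrite expRN expRM_natl lnK ?posrE// addn2 [in RHS]exprS invfM mulrA mulfV ?mul1r//.
rewrite mulrCA ler_pM2l//.
apply: (le_trans (ler_wpM2r (expR_ge0 _) nE)); rewrite -expRD ler_expR.
have yE : y = alpha * s%:R + beta * (178 / A * ln m%:R).
  by rewrite /y /block_rate -/A /Bconst; field; rewrite gt_eqF.
have hs : ln s.+1%:R <= s%:R :> R.
  by rewrite -add1n natrD; apply: le_ln1Dx; apply: lt_le_trans s1; lra.
have l0 := ln2_ge R; have Lge := entropy_ge R k s0.
set L := entropy R k s in W2 Lge *.
have as1 : 1 <= alpha * s%:R by rewrite -[leLHS]mulr1 ler_pM// ltW.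
(* the part of the exponent that pays for the cardinality and for [s] *)
have p1 : (k + 2)%:R * ln 2 + alpha * ln s.+1%:R <= 43 / 160 * W * (alpha * s%:R) - 3 / 2 * (L * s%:R).
  have q1 : L * s%:R <= W / 8 * (alpha * s%:R).
    rewrite mulrA ler_wpM2r//; apply: (@le_trans _ _ (W / 8)); first by lra.
    by rewrite ler_peMr ?ltW//; lra.
  (* By [q1] the cardinality uses [3 / 16] of [W]; of [43 / 160] there remain [13 / 160]. The
     summand [1] pays for [alpha * ln s.+1]. *)
  have q2 : (1 + (k + 2)%:R * ln 2) * (alpha * s%:R) <= 13 / 160 * W * (alpha * s%:R).
    rewrite ler_wpM2r ?(le_trans ler01)//; move: Lge; rewrite !natrD.
    have kl : 0 <= k%:R * ln 2 :> R by rewrite mulr_ge0//; lra.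
    by set x := k%:R in kl *; lra.
  have q3 : alpha * ln s.+1%:R <= alpha * s%:R by rewrite ler_wpM2l// (le_trans ler01 (ltW alpha1)).
  have q4 : (k + 2)%:R * ln 2 <= (k + 2)%:R * ln 2 * (alpha * s%:R).
    by rewrite ler_peMr// mulr_ge0//; lra.
  by move: q1 q2 q3 q4; set z := alpha * s%:R; set w := alpha * ln _; lra.
(* Numerically [43 / 160 * 8 * 22 / 3 * 178] is about [2806], which must exceed [9 / 8 * A]; the
   bound [2345] on [A] gives this, [2548] would not. *)
have p2 : beta * ln m.+1%:R <= 43 / 160 * W * (beta * (178 / A * ln m%:R)).
  rewrite mulrCA ler_wpM2l ?(le_trans _ (ltW beta1))//.
  apply: (le_trans (ln_succ_le R block_ge7)); rewrite mulrA ler_wpM2r//.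
  rewrite mulrA ler_pdivlMr//; have := Aconst_le R s0; rewrite -/A; lra.
rewrite yE; move: p1 p2; set z1 := alpha * s%:R; set z2 := beta * (_ * _).
set z3 := L * s%:R; set w1 := alpha * ln _; set w2 := beta * ln _; set w3 := (k + 2)%:R * ln 2; lra.
Qed.

(** This is the admissible range of the Bernstein bound. Levels [0] and [1] have variance bound
    [1 / 4] and use [8 * acoef 0 <= A]; beyond, minimality of the depth gives
    [threshold 0 < 2 ^ -K * M], while [8 / 3 * varbound k >= 2 ^ -(k - 1)]. *)
Lemma threshold_le k K : (k <= K.+1)%N ->
  (forall K', (K' < K)%N -> threshold 0 < (2 ^+ K'.+1)^-1 * M%:R) ->
  threshold k <= 8 / 3 * (M%:R * varbound R k).
Proof.
move=> kK Kmin.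
have M0 : 0 < M%:R :> R by rewrite ltr0n expn_gt0.
have y0 : 0 <= y by apply: le_trans y_ge1.
have t0 : threshold k <= threshold 0.
  by rewrite ler_wsqrtr// ler_wpM2r ?acoef_le_acoef0// mulr_ge0// ltW.
have small : threshold 0 <= 2 / 3 * M%:R.
  have z0 : 0 <= 2 / 3 * M%:R :> R by rewrite mulr_ge0// ?ltW//; lra.
  rewrite -(ger0_norm z0) -sqrtr_sqr ler_wsqrtr//.
  have A0 : 0 < A by apply: lt_le_trans A_ge.
  have yM : A * y <= M%:R by rewrite /y mulrC divfK ?gt_eqF// ltW.
  have := Aconst_ge R s0; rewrite -/A => a8.
  have ay : 8 * (acoef R 0 s * y) <= M%:R.
    by apply: le_trans yM; rewrite mulrA ler_wpM2r.
  rewrite mulrCA exprMn; move: ay M0; set w := acoef R 0 s * y; set x := M%:R; nra.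
apply: (le_trans t0); case: k kK {t0} => [|[|k]] kK.
- by rewrite /varbound/=; move: small; lra.
- by rewrite /varbound/= expr1; move: small; lra.
have [K' KE] : exists K', K = K'.+1 by case: K kK {Kmin} => // K' _; exists K'.
apply: (@le_trans _ _ ((2 ^+ K'.+1)^-1 * M%:R)); first by apply: ltW; apply: Kmin; rewrite KE.
rewrite mulrCA mulrC ler_wpM2l ?ler0n// /varbound/=.
have : (2 ^+ K'.+1)^-1 <= (2 ^+ k.+1)^-1 :> R.
  by rewrite lef_pV2 ?posrE ?exprn_gt0// ler_eXn2l ?ltr1n// -ltnS -KE.
have : (2 ^+ k.+1)^-1 <= 2^-1 :> R.
  by rewrite lef_pV2 ?posrE ?exprn_gt0// -[leLHS]expr1 ler_eXn2l ?ltr1n.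
rewrite [2 ^+ k.+2]exprS invfM; have : 0 < (2 ^+ k.+1)^-1 :> R by rewrite invr_gt0 exprn_gt0.
set x := (2 ^+ k.+1)^-1; set z := (2 ^+ K'.+1)^-1 => ? ? ?; nra.
Qed.

(** Take the least depth at which the bracketing error is below [threshold 0]; at depth [m] the
    error is [1], and [threshold 0 >= 1]. *)
Lemma exists_chain_depth : exists K, (2 ^+ K.+1)^-1 * M%:R <= threshold 0 /\
  (forall K', (K' < K)%N -> threshold 0 < (2 ^+ K'.+1)^-1 * M%:R).
Proof.
have M0 : 0 < M%:R :> R by rewrite ltr0n expn_gt0.
have t0 : 1 <= threshold 0.
  rewrite -[leLHS]sqrtr1 ler_wsqrtr//.
  have := acoef0_ge R s0; have M1 : 1 <= M%:R :> R by rewrite ler1n expn_gt0.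
  have : 1 <= M%:R * y by rewrite -[leLHS]mulr1 ler_pM.
  set w := M%:R * y; set a := acoef R 0 s; nra.
have ex : exists K, (2 ^+ K.+1)^-1 * M%:R <= threshold 0.
  by exists m; rewrite /M natrX mulVf// expf_neq0.
case: (ex_minnP ex) => K KP Kmin; exists K; split=> // K' K'K.
by rewrite ltNge; apply/negP => /Kmin; rewrite leqNgt K'K.
Qed.

(** The sum is at most [sqrt (A / 2) * sqrt (2 ^ (m + 1) * block_rate / A)]. *)
Lemma threshold_sum K : threshold 0 + \sum_(k < K) threshold k <=
  Num.sqrt (block_rate * (2 ^ m)%:R).
Proof.
have y0 : 0 <= y by apply: le_trans y_ge1.
have A0 : 0 < A by apply: lt_le_trans A_ge.
have My0 : 0 <= M%:R * y by rewrite mulr_ge0.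
have tE k : threshold k = Num.sqrt (acoef R k s) * Num.sqrt (M%:R * y).
  by rewrite /threshold sqrtrM// acoef_ge0.
under eq_bigr do rewrite tE; rewrite tE -mulr_suml -mulrDl.
apply: (@le_trans _ _ (chain_sum R s * Num.sqrt (M%:R * y))).
  by rewrite ler_wpM2r ?sqrtr_ge0// chain_sum_ge.
have c0 : 0 <= chain_sum R s.
  by apply: le_trans (chain_sum_ge2 R s0); rewrite mulr_ge0// sqrtr_ge0.
rewrite -[X in X * _](ger0_norm c0) -sqrtr_sqr -sqrtrM ?sqr_ge0// ler_wsqrtr//.
have : chain_sum R s ^+ 2 = A / 2 by rewrite /A AconstE; lra.
move=> ->; rewrite /y /M expnS natrM le_eqVlt; apply/orP; left; apply/eqP.
by field; rewrite gt_eqF.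
Qed.

End block_estimates.

Section block_event.
Context {R : realType} {d : measure_display} {T : measurableType d}.
Variables (P : probability T R) (X : nat -> nat -> {RV P >-> R}) (alpha beta : R) (s m : nat).
Hypothesis unifX : forall n j, uniform01 P (X n j).
Hypothesis indepX : mutually_independent P (fun ij : nat * nat => (X ij.1 ij.2 : T -> R)).
Hypothesis s0 : (0 < s)%N.
Hypothesis alpha1 : 1 < alpha.
Hypothesis beta1 : 1 < beta.
Let M : nat := (2 ^ m.+1)%N.
Hypothesis rate_small : block_rate alpha beta s m < M%:R.

Let tau := threshold alpha beta s m.
Let weight := block_weight alpha beta s m.
Let dev t n a b := box_dev s n (fun n j => X n j t) a b.

Let level_event (J : finType) (a b a' b' : J -> nat -> R) k t :=
  exists g, exists2 n, (n <= M)%N & tau k < `|dev t n (a g) (b g) - dev t n (a' g) (b' g)|.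

Let level_event_pr (J : finType) (a b a' b' : J -> nat -> R) k :
  (forall g, [/\ in01 s (a g), in01 s (b g), in01 s (a' g) & in01 s (b' g)]) ->
  (forall g, [/\ le_on s (a g) (a' g), le_on s (b' g) (b g) &
     box_vol s (a g) (b g) - box_vol s (a' g) (b' g) <= (2 ^+ k)^-1]) ->
  tau k <= 8 / 3 * (M%:R * varbound R k) ->
  #|J|%:R <= expR (3 / 2 * (entropy R k s * s%:R)) :> R ->
  measurable [set t | level_event a b a' b' k t] /\
  pr P [set t | level_event a b a' b' k t] <= (2 ^+ k.+1)^-1 * weight.
Proof.
move=> in1 nest tauk cardJ.
pose F g := [set t | exists2 n, (n <= M)%N & tau k < `|dev t n (a g) (b g) - dev t n (a' g) (b' g)|].
have FP g : measurable (F g) /\ pr P (F g) <=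
    2 * expR (- (43 / 160 * (tau k ^+ 2 / (M%:R * varbound R k)))).
  have [a1 b1 a1' b1'] := in1 g; have [aa bb vol] := nest g.
  apply: box_increment_bernstein => //; rewrite ?varbound_gt0 ?expn_gt0//; last first.
    by rewrite sqrtr_ge0.
  apply: varboundP => //; rewrite subr_ge0 le_box_vol//=.
  have /andP[v0 v1] := box_vol_in01 a1 b1; have /andP[v0' v1'] := box_vol_in01 a1' b1'.
  lra.
have [mU prU] := pr_bigcup_fin_le P (fun g => (FP g).1).
split=> //; apply: (le_trans prU).
apply: (le_trans (ler_sum _ (fun g _ => (FP g).2))).
rewrite sumr_const -[_ *+ #|_|]mulr_natl; apply: level_probability => //.
by rewrite ler0n.
Qed.

Lemma block_event_exists : exists F : set T, [/\ measurable F, pr P F <= weight &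
  forall t, ~ F t -> forall n a b, (n <= M)%N -> in01 s a -> in01 s b ->
    `|box_dev s n (fun n j => X n j t) a b| <=
    Num.sqrt (block_rate alpha beta s m * (2 ^ m)%:R)].
Proof.
have [K [Kle Kmin]] := exists_chain_depth m s0 alpha1 beta1.
have tau_le k : (k <= K.+1)%N -> tau k <= 8 / 3 * (M%:R * varbound R k).
  by move=> kK; apply: threshold_le Kmin.
have z01 : in01 s (fun=> 0 : R) by move=> j _; rewrite lexx ler01.
have o01 : in01 s (fun=> 1 : R) by move=> j _; rewrite lexx ler01.
(* Level [0] links to the empty box, levels [1] to [K] link inner boxes to their parents, and level
   [K.+1] links outer to inner boxes of depth [K]. *)
pose G (k : nat) : set T :=
  if k is k'.+1 then
    if (k' < K)%N then [set t | level_event (@inner_a R s k'.+1) (@inner_b R s k'.+1)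
       (fun g => inner_a R (chain_parent R s0 g)) (fun g => inner_b R (chain_parent R s0 g)) k'.+1 t]
    else [set t | level_event (@outer_a R s K) (@outer_b R s K)
       (@inner_a R s K) (@inner_b R s K) K.+1 t]
  else [set t | level_event (@inner_a R s 0) (@inner_b R s 0) (fun _ _ => 1) (fun _ _ => 0) 0 t].
have parentP k (g : box_index s k.+1) :
    brackets (chain_parent R s0 g) (inner_a R g) (inner_b R g).
  by apply: box_pickP; [exact: inner_a_in01|exact: inner_b_in01].
have GP (k : 'I_K.+2) : measurable (G k) /\ pr P (G k) <= (2 ^+ k.+1)^-1 * weight.
  case: k => [[|k] kK] /=.
    apply: level_event_pr; last exact: card_box_index_entropy.
    - by move=> g; split=> //; [exact: inner_a_in01|exact: inner_b_in01].
    - move=> g; have i1 := inner_a_in01 R s0 g; have i2 := inner_b_in01 R s0 g.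
      split=> [j js|j js|]; first by have /andP[] := i1 j js.
        by have /andP[] := i2 j js.
      have /andP[? ?] := box_vol_in01 i1 i2; have /andP[? ?] := box_vol_in01 o01 z01.
      by rewrite expr0 invr1; lra.
    - exact: tau_le.
  case: ifPn => kltK.
    apply: level_event_pr; last exact: card_box_index_entropy.
    - by move=> g; split; [exact: inner_a_in01|exact: inner_b_in01|exact: inner_a_in01|exact: inner_b_in01].
    (* An inner box lies between the inner and outer boxes of its parent, so the increment has at
       most the volume of the parent's bracket. *)
    - move=> g; have [oa ai ib bo] := parentP _ g; split=> //.
      apply: le_trans (box_index_vol R s0 (chain_parent R s0 g)).
      by rewrite lerD2r le_box_vol.
    - exact: tau_le.
  have -> : k = K by apply/eqP; rewrite eqn_leq [(K <= k)%N]leqNgt kltK andbT -ltnS; exact: kK.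
  apply: level_event_pr.
  - by move=> g; split; [exact: outer_a_in01|exact: outer_b_in01|exact: inner_a_in01|exact: inner_b_in01].
  - move=> g; split; [exact: outer_inner_a|exact: inner_outer_b|exact: box_index_vol].
  - exact: tau_le.
  - apply: (le_trans (card_box_index_entropy R s0 K)); rewrite ler_expR ler_wpM2l//.
    by rewrite ler_wpM2r// entropy_step.
have [mF prF] := pr_bigcup_fin_le P (fun k => (GP k).1).
exists [set t | exists k : 'I_K.+2, G k t]; split=> //.
  apply: (le_trans prF); apply: (le_trans (ler_sum _ (fun k _ => (GP k).2))).
  rewrite -mulr_suml ler_piMl ?mulr_ge0 ?powR_ge0//.
  suff -> : \sum_(k < K.+2) (2 ^+ k.+1)^-1 = 1 - (2 ^+ K.+2)^-1 :> R.
    by rewrite gerBl invr_ge0 exprn_ge0.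
  elim: (K.+2) => [|n IH]; first by rewrite big_ord0 expr0 invr1 subrr.
  rewrite big_ord_recr/= IH [2 ^+ n.+1]exprS invfM; lra.
move=> t nF n a b nM a1 b1.
have nG (k : nat) : (k < K.+2)%N -> ~ G k t.
  by move=> kK Gk; apply: nF; exists (Ordinal kK).
apply: (@le_trans _ _ (\sum_(k < K.+2) tau k + n%:R * (2 ^+ K.+1)^-1)).
  apply: (@chaining R s n K (fun n j => X n j t) tau s0) => // [g|k g kK|g].
  - rewrite leNgt; apply/negP => h; apply: (nG 0%N) => //.
    by exists g; exists n.
  - rewrite leNgt; apply/negP => h; apply: (nG k.+1); first by rewrite ltnS ltnW// ltnS.
    by rewrite /G kK; exists g; exists n.
  - rewrite leNgt; apply/negP => h; apply: (nG K.+1) => //.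
    by rewrite /G ltnn; exists g; exists n.
apply: le_trans (threshold_sum m s0 alpha1 beta1 K.+2).
(* The bracketing remainder takes the extra copy of [threshold 0], the summand of index [-1]. *)
rewrite addrC lerD2r; apply: le_trans Kle; rewrite mulrC ler_wpM2l ?ler_nat//.
Qed.
End block_event.

(** * Measurability *)

Section discrepancy.
Variable R : realType.
Implicit Types (pts : nat -> nat -> R) (a b : nat -> R).

Lemma box_devE_ratio s N pts a b : (0 < N)%N ->
  `|(box_count s N pts a b)%:R / N%:R - box_vol s a b| = `|box_dev s N pts a b| / N%:R.
Proof.
move=> N0; have N0R : 0 < N%:R :> R by rewrite ltr0n.
rewrite -[X in _ = _ / X](ger0_norm (ltW N0R)) -normf_div; congr `|_|.
by rewrite /box_dev; field; rewrite gt_eqF.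
Qed.

Lemma box_ratio_le1 s N pts a b : (0 < N)%N -> in01 s a -> in01 s b ->
  `|(box_count s N pts a b)%:R / N%:R - box_vol s a b| <= 1.
Proof.
move=> N0 a1 b1; have N0R : 0 < N%:R :> R by rewrite ltr0n.
have /andP[v0 v1] := box_vol_in01 a1 b1.
have c0 : 0 <= (box_count s N pts a b)%:R / N%:R :> R by rewrite divr_ge0.
have c1 : (box_count s N pts a b)%:R / N%:R <= 1 :> R.
  rewrite ler_pdivrMr// mul1r ler_nat -[leqRHS]card_ord -sum1_card leq_sum// => i _.
  exact: leq_b1.
by rewrite ler_norml; apply/andP; split; lra.
Qed.

(** The set is nonempty and bounded by [1], so [sup] is a genuine least upper bound and no default
    value. *)
Lemma discrepancy_leP s N pts c : (0 < N)%N ->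
  (discrepancy s N pts <= c) <-> (forall a b, in01 s a -> in01 s b ->
    `|(box_count s N pts a b)%:R / N%:R - box_vol s a b| <= c).
Proof.
move=> N0; rewrite /discrepancy; set E := [set r | _].
have z01 : in01 s (fun=> 0 : R) by move=> j _; rewrite lexx ler01.
have E0 : E !=set0 by eexists; exists (fun=> 0), (fun=> 0).
split=> h.
  move=> a b a1 b1; apply: le_trans h; apply: ub_le_sup; last by exists a, b.
  by exists 1 => _ [a' [b' [a1' [b1' ->]]]]; exact: box_ratio_le1.
by apply: ge_sup => // _ [a [b [a1 [b1 ->]]]]; exact: h.
Qed.

Lemma discrepancy_le1 s N pts : (0 < N)%N -> discrepancy s N pts <= 1.
Proof. by move=> N0; apply/discrepancy_leP => // a b; exact: box_ratio_le1. Qed.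

Lemma prod_lipschitz n (f g : nat -> R) : in01 n f -> in01 n g ->
  `|\prod_(j < n) f j - \prod_(j < n) g j| <= \sum_(j < n) `|f j - g j|.
Proof.
elim: n => [|n IH] f1 g1; first by rewrite !big_ord0 subrr normr0.
have w (h : nat -> R) : in01 n.+1 h -> in01 n h by move=> h1 j jn; apply: h1; rewrite ltnS ltnW.
have p01 : 0 <= \prod_(j < n) g j <= 1.
  rewrite prodr_ge0 ?prodr_ile1// => j _; have /andP[] := w _ g1 j (ltn_ord j) => //.
  by move=> -> ->.
have /andP[p0 p1] := p01; have /andP[f0 ff1] := f1 n (ltnSn n).
rewrite !big_ord_recr/=; have {}IH := IH (w _ f1) (w _ g1).
set F := \prod_(j < n) f j in IH *; set G := \prod_(j < n) g j in IH p0 p1 *.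
have -> : F * f n - G * g n = (F - G) * f n + G * (f n - g n) by ring.
apply: (le_trans (ler_normD _ _)); rewrite !normrM (ger0_norm f0) (ger0_norm p0) lerD//.
  by apply: le_trans IH; rewrite ler_piMr.
by rewrite ler_piMl.
Qed.

(** For [v > 0] the rational is taken just below [v] but above every [x k < v], so no strict
    comparison with the finitely many coordinates changes. *)
Lemma rat_approx N (x : nat -> R) (v e : R) : 0 <= v <= 1 -> 0 < e ->
  exists q : rat, [/\ 0 <= (ratr q : R) <= 1, `|ratr q - v| <= e &
    forall k, (k < N)%N -> (x k < ratr q) = (x k < v)].
Proof.
move=> /andP[v0 v1] e0.
have [->|vn0] := eqVneq v 0.
  by exists 0; rewrite raddf0 lexx ler01 subrr normr0 ltW.
have {}v0 : 0 < v by rewrite lt_neqAle eq_sym vn0.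
have [l [lv l0 le lx]] : exists l, [/\ l < v, 0 <= l, v - e <= l &
    forall k, (k < N)%N -> x k < v -> x k <= l].
  elim: N => [|N [l [lv l0 le lx]]].
    exists (Num.max 0 (v - e)); split=> //.
    - by rewrite gt_max v0 gtrBl.
    - by rewrite le_max lexx.
    - by rewrite le_max lexx orbT.
  have [xv|xv] := ltP (x N) v; last first.
    exists l; split=> // k; rewrite ltnS leq_eqVlt => /predU1P[->|]; last exact: lx.
    by rewrite ltNge xv.
  exists (Num.max l (x N)); split=> //.
  - by rewrite gt_max lv.
  - by rewrite le_max l0.
  - by rewrite le_max le.
  - move=> k; rewrite ltnS leq_eqVlt le_max => /predU1P[-> _|kN xk].
      by rewrite lexx orbT.
    by rewrite lx.
have [q] := rat_in_itvoo lv; rewrite in_itv/= => /andP[lq qv].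
exists q; split=> [||k kN].
- by rewrite (le_trans l0 (ltW lq)) (le_trans (ltW qv) v1).
- by rewrite ler0_norm ?subr_le0 ?(ltW qv)//; lra.
- apply/idP/idP => [xq|xv]; first exact: lt_trans qv.
  exact: le_lt_trans (lx k kN xv) lq.
Qed.

Definition rat_corner s (q : {ffun 'I_s -> rat}) : nat -> R := extend0 (fun j => ratr (q j)).

Let rat_cornerE s (q : {ffun 'I_s -> rat}) (j : 'I_s) : rat_corner q j = ratr (q j).
Proof. by rewrite /rat_corner /extend0 valK. Qed.

Let max0_lipschitz (u v : R) : `|Num.max u 0 - Num.max v 0| <= `|u - v|.
Proof.
have h1 := ler_norm (u - v); have h2 := ler_norm (v - u).
rewrite distrC in h2; have h3 := normr_ge0 (u - v).
by rewrite /Num.max; case: ltP => ?; case: ltP => ?; rewrite ler_norml; apply/andP; split; lra.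
Qed.

(** Rational corners reproduce the count exactly and the volume up to any [e], which reduces the
    supremum to countably many boxes. *)
Lemma discrepancy_rat_leP s N pts c : (0 < N)%N ->
  (discrepancy s N pts <= c) <-> (forall q r : {ffun 'I_s -> rat},
    in01 s (rat_corner q) -> in01 s (rat_corner r) ->
    `|box_dev s N pts (rat_corner q) (rat_corner r)| / N%:R <= c).
Proof.
move=> N0; rewrite discrepancy_leP//; split=> h.
  by move=> q r q1 r1; rewrite -box_devE_ratio//; exact: h.
move=> a b a1 b1; apply/ler_addgt0Pr => e e0.
(* Each side changes by at most [2 d], and [s] sides by at most [e]; the summand [1] covers
   [s = 0]. *)
have d0 : 0 < e / (s%:R + 1) / 2 by rewrite divr_gt0// divr_gt0// ltr_wpDl.
set d := e / (s%:R + 1) / 2 in d0.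
have corner v : in01 s v -> exists q : {ffun 'I_s -> rat}, [/\ in01 s (rat_corner q),
    (forall j : 'I_s, `|rat_corner q j - v j| <= d) &
    (forall (j : 'I_s) k, (k < N)%N -> (pts k j < rat_corner q j) = (pts k j < v j))].
  move=> v1.
  have /choice[q qP] : forall j : 'I_s, exists q : rat, [/\ 0 <= (ratr q : R) <= 1,
      `|ratr q - v j| <= d & forall k, (k < N)%N -> (pts k j < ratr q) = (pts k j < v j)].
    by move=> j; exact: (rat_approx N (fun k => pts k j) (v1 j (ltn_ord j)) d0).
  exists [ffun j => q j]; split=> [j js|j|j k kN].
  - by rewrite -[j]/(val (Ordinal js)) rat_cornerE ffunE; have [] := qP (Ordinal js).
  - by rewrite rat_cornerE ffunE; have [] := qP j.
  - by rewrite rat_cornerE ffunE; have [_ _ ->] := qP j.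
have [q [q1 qa qc]] := corner a a1; have [r [r1 rb rc]] := corner b b1.
have cnt : box_count s N pts a b = box_count s N pts (rat_corner q) (rat_corner r).
  apply: eq_bigr => k _; congr nat_of_bool; apply: eq_forallb => j.
  by rewrite !leNgt qc// rc.
have vol : `|box_vol s (rat_corner q) (rat_corner r) - box_vol s a b| <= e.
  have m01 u v : in01 s u -> in01 s v -> in01 s (fun j => Num.max (v j - u j) 0 : R).
    move=> u1 v1 j js; have /andP[? ?] := u1 j js; have /andP[? ?] := v1 j js.
    rewrite le_max lexx orbT/= ge_max ler01 andbT; lra.
  apply: (le_trans (prod_lipschitz (m01 _ _ q1 r1) (m01 _ _ a1 b1))).
  apply: (@le_trans _ _ (\sum_(j < s) (d *+ 2))).
    apply: ler_sum => j _; apply: (le_trans (max0_lipschitz _ _)).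
    have -> : rat_corner r j - rat_corner q j - (b j - a j) =
      (rat_corner r j - b j) - (rat_corner q j - a j) by ring.
    by apply: (le_trans (ler_normB _ _)); rewrite mulr2n lerD.
  rewrite sumr_const card_ord -[_ *+ s]mulr_natl mulr2n.
  have S0 : 0 < s%:R + 1 :> R by rewrite ltr_wpDl.
  have -> : d + d = e / (s%:R + 1) by rewrite /d; lra.
  rewrite mulrCA ler_piMr ?(ltW e0)// ler_pdivrMr// mul1r; lra.
have := h q r q1 r1; rewrite -box_devE_ratio// -cnt.
move: vol; set x := box_vol s a b; set x' := box_vol _ _ _; set z := _ / _ => xx' zx'.
have -> : z - x = (z - x') + (x' - x) by ring.
by apply: (le_trans (ler_normD _ _)); rewrite lerD.
Qed.
End discrepancy.

Section measurability.
Context {R : realType} {d : measure_display} {T : measurableType d}.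
Variables (P : probability T R) (X : nat -> nat -> {RV P >-> R}).

Lemma measurable_box_dev s N a b :
  measurable_fun setT (fun t => box_dev s N (fun n j => X n j t) a b).
Proof.
rewrite (_ : (fun t => _) = (fun t => \sum_(n < N)
    (\1_(box_event X s n a b) t - box_vol s a b))); last first.
  by apply/funext => t; exact: box_devE.
apply: measurable_sum => n; apply: measurable_funB => //.
by apply: measurable_indic; exact: measurable_box_event.
Qed.

Lemma measurable_discrepancy_le s N c : (0 < N)%N ->
  measurable [set t | discrepancy s N (fun n j => X n j t) <= c].
Proof.
move=> N0.
pose bad (qr : {ffun 'I_s -> rat} * {ffun 'I_s -> rat}) : set T :=
  if pselect (in01 s (rat_corner R qr.1) /\ in01 s (rat_corner R qr.2)) then
    [set t | c < `|box_dev s N (fun n j => X n j t) (rat_corner R qr.1) (rat_corner R qr.2)| / N%:R]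
  else set0.
have -> : [set t | discrepancy s N (fun n j => X n j t) <= c] = ~` \bigcup_qr bad qr.
  apply/seteqP; split=> t.
    move=> /(discrepancy_rat_leP _ _ _ N0) h [[q r] _]; rewrite /bad/=.
    by case: pselect => // -[q1 r1] /=; rewrite ltNge (h q r q1 r1).
  move=> h; apply/(discrepancy_rat_leP _ _ _ N0) => q r q1 r1.
  rewrite leNgt; apply/negP => cq; apply: h; exists (q, r) => //.
  by rewrite /bad/=; case: pselect => //= -[].
apply: measurableC; apply: countable_bigcupT_measurable; first exact: countableP.
move=> qr; rewrite /bad; case: pselect => ? //=.
rewrite (_ : [set t | _] = (fun t => `|box_dev s N (fun n j => X n j t)
    (rat_corner R qr.1) (rat_corner R qr.2)| / N%:R) @^-1` `]c, +oo[); last first.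
  by apply/seteqP; split=> t /=; rewrite in_itv/= andbT.
rewrite -[X in measurable X]setTI.
apply: measurable_funM => //.
by apply: (measurableT_comp (@normr_measurable _ _)) => //; exact: measurable_box_dev.
Qed.

Lemma measurable_good_event alpha beta :
  measurable (good_event (fun n j => (X n j : T -> R)) alpha beta).
Proof.
pose G s N : set T := if (0 < s)%N && (2 <= N)%N then
  [set t | discrepancy s N (fun n j => X n j t) <=
    Num.sqrt (alpha * Aconst R s + beta * Bconst R * ln (log2 N%:R) / s%:R)
       * Num.sqrt (s%:R / N%:R)] else setT.
have -> : good_event (fun n j => (X n j : T -> R)) alpha beta = \bigcap_s \bigcap_N G s N.
  apply/seteqP; split=> t.
    by move=> h s _ N _; rewrite /G; case: ifP => // /andP[s0 N2]; exact: h.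
  by move=> h s N s0 N2; have := h s I N I; rewrite /G s0 N2.
apply: bigcapT_measurable => s; apply: bigcapT_measurable => N.
rewrite /G; case: ifP => // /andP[s0 N2]; apply: measurable_discrepancy_le.
exact: ltnW.
Qed.

End measurability.

(** * The series over dimensions and blocks *)

Section zeta_series.
Variables (R : realType) (x : R).
Hypothesis x1 : 1 < x.

Let psum M : R := \sum_(1 <= n < M) n%:R `^ (- x).

Let psum_nd : {homo psum : n m / (n <= m)%N >-> n <= m}.
Proof.
apply/nondecreasing_seqP => -[|n]; first by rewrite /psum !big_geq.
by rewrite /psum [leRHS]big_nat_recr//= lerDl powR_ge0.
Qed.

(* Cauchy condensation *)
Let psum_dyadic k : psum (2 ^ k) <= \sum_(j < k) (2 `^ (1 - x)) ^+ j.
Proof.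
elim: k => [|k IH]; first by rewrite /psum big_geq// big_ord0.
rewrite big_ord_recr/= /psum (@big_cat_nat _ _ _ (2 ^ k)%N)/=; first last.
- by rewrite leq_exp2l.
- by rewrite expn_gt0.
apply: lerD => //.
have p0 : 0 < (2 ^ k)%:R :> R by rewrite ltr0n expn_gt0.
apply: (@le_trans _ _ (\sum_(2 ^ k <= n < 2 ^ k.+1) (2 ^ k)%:R `^ (- x))).
  apply: ler_sum_nat => n /andP[kn _].
  rewrite !powRN lef_pV2 ?posrE ?powR_gt0 ?ltr0n ?expn_gt0//; last first.
    by rewrite (leq_trans _ kn)// expn_gt0.
  by apply: ge0_ler_powR; rewrite ?nnegrE ?ler_nat// (le_trans ler01 (ltW x1)).
rewrite sumr_const_nat expnS mul2n -addnn addnK -[_ *+ (2 ^ k)]mulr_natl.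
rewrite -{1}[(2 ^ k)%:R]powRr1 ?(ltW p0)// -powRD; last by apply/implyP => _; rewrite gt_eqF.
by rewrite natrX -[2 ^+ k]powR_mulrn// -powRrM mulrC powRrM powR_mulrn ?powR_ge0.
Qed.

Let psum_cvg : cvgn psum.
Proof.
have r0 : 0 <= 2 `^ (1 - x) :> R by exact: powR_ge0.
have r1 : 2 `^ (1 - x) < 1 :> R.
  have h : 1 - x < 0 by rewrite subr_lt0.
  by rewrite /powR pnatr_eq0/= expR_lt1 (nmulr_rlt0 _ h) ln_gt0// ltr1n.
apply: nondecreasing_is_cvgn => //.
exists ((1 - 2 `^ (1 - x))^-1) => _ [n _ <-].
apply: (@le_trans _ _ (psum (2 ^ n))); first by apply: psum_nd; exact/ltnW/ltn_expl.
apply: (le_trans (psum_dyadic n)).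
rewrite -div1r ler_pdivlMr ?subr_gt0// mulrC -opprB mulNr -subrX1 opprB gerBl.
by rewrite exprn_ge0.
Qed.

Lemma zeta_ge_psum M : \sum_(0 <= m < M) m.+1%:R `^ (- x) <= zeta x.
Proof.
rewrite -(big_add1 _ _ 0%N M.+1 xpredT (fun n : nat => n%:R `^ (- x)))/=.
exact: nondecreasing_cvgn_le psum_nd psum_cvg M.+1.
Qed.

Lemma zeta_tail_le M : \sum_(0 <= m < M) m.+2%:R `^ (- x) <= zeta x - 1.
Proof.
have := zeta_ge_psum M.+1; rewrite big_nat_recl//= powR1; lra.
Qed.

(** The removed term [n = 2] belongs to the block [m = 1], which contributes no exceptional set. *)
Lemma zeta_tail2_le M : \sum_(0 <= m < M) m.+3%:R `^ (- x) <= zeta x - 1 - 2 `^ (- x).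
Proof.
have := zeta_tail_le M.+1; rewrite big_nat_recl//=; lra.
Qed.

Lemma zeta_gt1 : 1 < zeta x.
Proof.
have := zeta_tail_le 1; rewrite big_nat1.
have : 0 < 2 `^ (- x) by rewrite powR_gt0.
lra.
Qed.

End zeta_series.

Section countable_union.
Context {d : measure_display} {T : measurableType d} {R : realType}.
Variable P : probability T R.

Lemma pr_bigcup_le (F : nat -> set T) (c : nat -> R) (C : R) :
  (forall n, measurable (F n)) -> (forall n, pr P (F n) <= c n) ->
  (forall M, \sum_(0 <= n < M) c n <= C) -> pr P (\bigcup_n F n) <= C.
Proof.
move=> mF Fc cC; have mU : measurable (\bigcup_n F n) by exact: bigcupT_measurable.
rewrite -lee_fin pr_fineK//.
apply: (le_trans (generalized_Boole_inequality P mF mU)).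
apply: lime_le; first by apply: is_cvg_nneseries.
have e n : P (F n) = (pr P (F n))%:E by rewrite pr_fineK.
apply: nearW => M /=; under eq_bigr do rewrite e.
rewrite sumEFin lee_fin; apply: le_trans (cC M).
exact: ler_sum.
Qed.

End countable_union.

(** * Discrepancy within a block and total failure probability *)

Section block_bound.
Context {R : realType} {d : measure_display} {T : measurableType d}.
Variables (P : probability T R) (X : nat -> nat -> {RV P >-> R}) (alpha beta : R).
Hypothesis unifX : forall n j, uniform01 P (X n j).
Hypothesis indepX : mutually_independent P (fun ij : nat * nat => (X ij.1 ij.2 : T -> R)).
Hypothesis alpha1 : 1 < alpha.
Hypothesis beta1 : 1 < beta.

Let bound s N : R := Num.sqrt (alpha * Aconst R s + beta * Bconst R * ln (log2 N%:R) / s%:R)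
  * Num.sqrt (s%:R / N%:R).

(** On the block [m <= log2 N], so [s] times the first radicand of [bound] is at least
    [block_rate]. *)
Let boundE s m N : (0 < s)%N -> (0 < m)%N -> (2 ^ m <= N)%N ->
  Num.sqrt (block_rate alpha beta s m / N%:R) <= bound s N.
Proof.
move=> s0 m0 mN; have sR : 0 < s%:R :> R by rewrite ltr0n.
have N0 : 0 < N%:R :> R by rewrite ltr0n (leq_trans _ mN)// expn_gt0.
have mR : 0 < m%:R :> R by rewrite ltr0n.
have l2 : 0 < ln 2 :> R by rewrite ln_gt0// ltr1n.
have mlog : m%:R <= log2 N%:R :> R.
  rewrite /log2 ler_pdivlMr// -ln2X ler_ln ?posrE ?exprn_gt0//.
  by rewrite -natrX ler_nat.
have lnlog : ln m%:R <= ln (log2 N%:R) :> R by rewrite ler_ln// posrE (lt_le_trans mR).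
have lnm0 : 0 <= ln m%:R :> R by rewrite ln_ge0// ler1n.
have A0 : 0 <= Aconst R s by rewrite /Aconst mulr_ge0// sqr_ge0.
have bB : 0 <= beta * Bconst R by rewrite /Bconst mulr_ge0// (le_trans ler01 (ltW beta1)).
have w0 : 0 <= alpha * Aconst R s + beta * Bconst R * ln (log2 N%:R) / s%:R.
  apply: addr_ge0; first by rewrite mulr_ge0// (le_trans ler01 (ltW alpha1)).
  by rewrite divr_ge0 ?(ltW sR)// mulr_ge0// (le_trans lnm0).
rewrite /bound -sqrtrM// ler_wsqrtr// mulrA ler_wpM2r ?invr_ge0 ?(ltW N0)//.
by rewrite mulrDl divfK ?gt_eqF// /block_rate lerD2l ler_wpM2l.
Qed.

(** A large rate makes the bound at least [1] and the exceptional set empty. A small rate forces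
    [m >= 7], which allows weight [0] for [m < 2]. *)
Lemma block_discrepancy s m : (0 < s)%N -> exists F : set T, [/\ measurable F,
  pr P F <= s.+1%:R `^ (- alpha) * (if (2 <= m)%N then m.+1%:R `^ (- beta) else 0) &
  forall t, ~ F t -> forall N, (0 < m)%N -> (2 ^ m <= N < 2 ^ m.+1)%N ->
    discrepancy s N (fun n j => X n j t) <= bound s N].
Proof.
move=> s0; have [small|big] := ltP (block_rate alpha beta s m) (2 ^ m.+1)%:R.
  have m7 := block_ge7 s0 alpha1 beta1 small.
  have [F [mF prF FP]] := block_event_exists unifX indepX s0 alpha1 beta1 small.
  exists F; split=> //; first by rewrite (leq_trans _ m7).
  move=> t nF N m0 /andP[mN Nm].
  have N0 : (0 < N)%N by rewrite (leq_trans _ mN)// expn_gt0.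
  have N0R : 0 < N%:R :> R by rewrite ltr0n.
  apply: le_trans (boundE s0 m0 mN); apply/discrepancy_leP => // a b a1 b1.
  rewrite box_devE_ratio// ler_pdivrMr//.
  apply: (le_trans (FP t nF N a b (ltnW Nm) a1 b1)).
  have r0 : 0 <= block_rate alpha beta s m.
    have lnm0 : 0 <= ln m%:R :> R by rewrite ln_ge0// ler1n.
    have A0 : 0 <= Aconst R s by rewrite /Aconst mulr_ge0// sqr_ge0.
    have [al0 be0] := (le_trans ler01 (ltW alpha1), le_trans ler01 (ltW beta1)).
    have [alA beB] := (mulr_ge0 al0 A0, mulr_ge0 be0 (ler0n R 178)).
    exact: addr_ge0 (mulr_ge0 alA (ler0n _ _)) (mulr_ge0 beB lnm0).
  (* Moving [N] under the root reduces the claim to [2 ^ m <= N]. *)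
  rewrite -[X in _ <= _ * X](ger0_norm (ltW N0R)) -sqrtr_sqr -sqrtrM ?divr_ge0 ?(ltW N0R)//.
  rewrite ler_wsqrtr// expr2 mulrA divfK ?gt_eqF// ler_wpM2l// ler_nat//.
exists set0; split=> //.
  by rewrite pr0 mulr_ge0 ?powR_ge0//; case: ifP => // _; exact: powR_ge0.
move=> t _ N m0 /andP[mN Nm].
have N0 : (0 < N)%N by rewrite (leq_trans _ mN)// expn_gt0.
apply: (le_trans (discrepancy_le1 _ _ N0)); apply: le_trans (boundE s0 m0 mN).
rewrite -[leLHS]sqrtr1 ler_wsqrtr// ler_pdivlMr ?ltr0n// mul1r.
by apply: le_trans big; rewrite ler_nat ltnW.
Qed.

(** Every [N >= 2] lies in the block [trunc_log 2 N >= 1], so each failure falls in an exceptional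
    set; two union bounds give the product of the tails. Index [s] stands for dimension [s.+1]. *)
Lemma pr_good_eventC :
  pr P (~` good_event (fun n j => (X n j : T -> R)) alpha beta) <=
  (zeta alpha - 1) * (zeta beta - 1 - 2 `^ (- beta)).
Proof.
have /choice[F FP] : forall sm : nat * nat, exists F : set T, [/\ measurable F,
    pr P F <= sm.1.+2%:R `^ (- alpha) * (if (2 <= sm.2)%N then sm.2.+1%:R `^ (- beta) else 0) &
    forall t, ~ F t -> forall N, (0 < sm.2)%N -> (2 ^ sm.2 <= N < 2 ^ sm.2.+1)%N ->
    discrepancy sm.1.+1 N (fun n j => X n j t) <= bound sm.1.+1 N].
  by move=> [s m]; exact: block_discrepancy.
pose G s := \bigcup_m F (s, m).
have mF s m : measurable (F (s, m)) by have [] := FP (s, m).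
have mG s : measurable (G s) by exact: bigcupT_measurable.
have Zb : 0 <= zeta beta - 1 - 2 `^ (- beta).
  by have := zeta_tail2_le beta1 0; rewrite big_geq.
have prG s : pr P (G s) <= s.+2%:R `^ (- alpha) * (zeta beta - 1 - 2 `^ (- beta)).
  apply: (pr_bigcup_le (c := fun m => s.+2%:R `^ (- alpha) *
    (if (2 <= m)%N then m.+1%:R `^ (- beta) else 0))) => // [m|M].
    by have [] := FP (s, m).
  rewrite -mulr_sumr ler_wpM2l ?powR_ge0//; apply: le_trans (zeta_tail2_le beta1 M).
  case: M => [|[|M]]; [by rewrite !big_geq|by rewrite !big_nat1 powR_ge0|].
  rewrite big_nat_recl// big_nat_recl//= !add0r [leRHS]big_nat_recr//= [X in _ <= X + _]big_nat_recr//=.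
  by rewrite -addrA lerDl addr_ge0 ?powR_ge0.
have mgood := measurable_good_event X alpha beta.
apply: (@le_trans _ _ (pr P (\bigcup_s G s))).
  apply: le_pr => //; [exact: measurableC|exact: bigcupT_measurable|].
  move=> t /= ngood; apply/not_notP => nG; apply: ngood => s N s0 N2.
  have [s' sE] : exists s', s = s'.+1 by case: s s0 => // s' _; exists s'.
  have N0 : (0 < N)%N by exact: ltnW.
  rewrite sE; have [_ _] := FP (s', trunc_log 2 N); apply.
  - by move=> Ft; apply: nG; exists s' => //; exists (trunc_log 2 N).
  - by rewrite /= trunc_log_gt0.
  - exact: trunc_log_bounds.
apply: (pr_bigcup_le (c := fun s => s.+2%:R `^ (- alpha) * (zeta beta - 1 - 2 `^ (- beta)))) => // M.
by rewrite -mulr_suml ler_wpM2r// zeta_tail_le.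
Qed.

End block_bound.

Theorem theorem5 (R : realType) (d : measure_display) (T : measurableType d)
  (P : probability T R) (X : nat -> nat -> {RV P >-> R}) (alpha beta : R) :
  (forall n j, uniform01 P (X n j)) ->
  mutually_independent P (fun ij : nat * nat => (X ij.1 ij.2 : T -> R)) ->
  1 < alpha -> 1 < beta ->
  (zeta alpha - 1) * (zeta beta - 1) < 1 ->
  [/\ measurable (good_event (fun n j => (X n j : T -> R)) alpha beta),
      ((1 - (zeta alpha - 1) * (zeta beta - 1))%:E
         < P (good_event (fun n j => (X n j : T -> R)) alpha beta))%E
    & forall s : nat, (0 < s)%N -> Aconst R s <= 2548].
Proof.
move=> unifX indepX alpha1 beta1 _.
have mgood := measurable_good_event X alpha beta.
split=> //; last by move=> s s0; apply: (le_trans (Aconst_le R s0)); lra.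
rewrite -pr_fineK// lte_fin.
have := pr_good_eventC unifX indepX alpha1 beta1; rewrite prC//.
(* Strictness comes from the positive slack [(zeta alpha - 1) * 2 ^ (- beta)]. *)
have := zeta_gt1 alpha1; have : 0 < 2 `^ (- beta) by rewrite powR_gt0.
by set x := 2 `^ _; set y := pr _ _; nra.
Qed.
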